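(* Let $(M,\mathcal{T})$ be a triangulated compact 3-manifold. The sphere packing metrics with nonpositive constant combinatorial scalar curvature are isolated in $\mathfrak{M}_{\mathcal{T}}\cap\mathbb{S}^{N-1}$; that is, every $r^*\in\mathfrak{M}_{\mathcal{T}}\cap\mathbb{S}^{N-1}$ with nonpositive constant combinatorial scalar curvature has a neighborhood in $\mathfrak{M}_{\mathcal{T}}\cap\mathbb{S}^{N-1}$ containing no other sphere packing metric with nonpositive constant combinatorial scalar curvature.
   Context: $M$ is a compact connected 3-dimensional manifold (without boundary) with a triangulation $\mathcal{T}=\{V,E,F,T\}$ (vertices, edges, faces, tetrahedra), $V=\{1,\dots,N\}$. A sphere packing metric is a map $r:V\to(0,+\infty)$ such that, with edge lengths $l_{ij}=r_i+r_j$ for $\{i,j\}\in E$, each tetrahedron $\{i,j,k,l\}\in T$ is realized by its six edge lengths as a (nondegenerate) Euclidean tetrahedron; equivalently $Q_{ijkl}=\left(\frac1{r_i}+\frac1{r_j}+\frac1{r_k}+\frac1{r_l}\right)^2-2\left(\frac1{r_i^2}+\frac1{r_j^2}+\frac1{r_k^2}+\frac1{r_l^2}\right)>0$ for every $\{i,j,k,l\}\in T$. The set of all sphere packing metrics is $\mathfrak{M}_{\mathcal{T}}\subset\mathbb{R}^N_{>0}$. Let $\alpha_{ijkl}$ be the solid angle at $i$ of the Euclidean tetrahedron $\{i,j,k,l\}$ and $K_i=4\pi-\sum_{\{i,j,k,l\}\in T}\alpha_{ijkl}$ (sum over tetrahedra containing $i$). The combinatorial scalar curvature is $R_i=K_i/r_i^2$;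 it is a nonpositive constant if there is $\lambda\le0$ with $R_i=\lambda$ for all $i\in V$. Here $\mathbb{S}^{N-1}=\{r\in\mathbb{R}^N:\ (\sum_i r_i^3)^{1/3}=1\}$. *)

(* Defs.v *)
From HB Require Import structures.
From mathcomp Require Import all_boot all_order all_algebra.
From mathcomp Require Import all_classical all_reals all_analysis.

Set Implicit Arguments.
Unset Strict Implicit.
Unset Printing Implicit Defensive.

Import Order.TTheory GRing.Theory Num.Theory.
Import numFieldNormedType.Exports.

Local Open Scope classical_set_scope.
Local Open Scope ring_scope.

(* Both sets carry the subspace topology. *)
Definition homeomorphic (X Y : topologicalType) (A : set X) (B : set Y) : Prop :=
  exists (f : X -> Y) (g : Y -> X),
    [/\ {within A, continuous f}, {within B, continuous g},
        (forall x, A x -> B (f x)) /\ (forall y, B y -> A (g y)),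
        (forall x, A x -> g (f x) = x) &
        (forall y, B y -> f (g y) = y)].

Definition locally_euclidean3 (R : realType) (M : topologicalType) : Prop :=
  forall x : M, exists (U : set M) (W : set 'rV[R]_3),
    [/\ open U, U x, open W & homeomorphic U W].

(* All charts are modelled on open subsets of R^3, so there is no boundary. *)
Definition compact_connected_3manifold (R : realType) (M : topologicalType)
    : Prop :=
  [/\ hausdorff_space M, @second_countable M, locally_euclidean3 R M,
      compact [set: M] & connected [set: M]].

(* A set [T] of tetrahedra on the vertices 'I_N (i.e. vertex sets) generates
   the simplicial complex whose simplices are the nonempty subsets of the
   members of [T]: edges and faces are those of the tetrahedra.  The geometric
   realization is given in barycentric coordinates. *)
Definition realization (R : realType) (N : nat) (T : {set {set 'I_N}})
    : set 'rV[R]_N :=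
  [set x : 'rV[R]_N |
    [/\ forall i, 0 <= x 0 i, \sum_i x 0 i = 1 &
        exists2 t, t \in T & forall i, x 0 i != 0 -> i \in t]].
Arguments realization R {N} T.

Definition triangulates (R : realType) (N : nat) (T : {set {set 'I_N}})
    (M : topologicalType) : Prop :=
  [/\ forall t, t \in T -> #|t| = 4%N,
      forall i : 'I_N, exists2 t, t \in T & i \in t &
      homeomorphic (realization R T) [set: M]].

Definition enorm (R : realType) (v : 'rV[R]_3) : R :=
  Num.sqrt (\sum_k v 0 k ^+ 2).

Definition affinely_independent (R : realType) (N : nat) (t : {set 'I_N})
    (p : 'I_N -> 'rV[R]_3) : Prop :=
  forall c : 'I_N -> R, \sum_(j in t) c j = 0 ->
    \sum_(j in t) c j *: p j = 0 -> forall j, j \in t -> c j = 0.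

(* [p] places the vertices of [t] in R^3 as a nondegenerate tetrahedron with
   edge lengths r_i + r_j; the values of [p] outside [t] are irrelevant. *)
Definition tetra_placement (R : realType) (N : nat) (r : 'rV[R]_N)
    (t : {set 'I_N}) : set ('I_N -> 'rV[R]_3) :=
  [set p : 'I_N -> 'rV[R]_3 | affinely_independent t p /\
    forall i j, i \in t -> j \in t -> i != j ->
      enorm (p i - p j) = r 0 i + r 0 j].

Definition sphere_packing_metric (R : realType) (N : nat)
    (T : {set {set 'I_N}}) : set 'rV[R]_N :=
  [set r : 'rV[R]_N | (forall i, 0 < r 0 i) /\
    forall t, t \in T -> exists p, tetra_placement r t p].

Definition corner_cone (R : realType) (N : nat) (t : {set 'I_N})
    (p : 'I_N -> 'rV[R]_3) (i : 'I_N) : set 'rV[R]_3 :=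
  [set v : 'rV[R]_3 | exists2 c : 'I_N -> R, forall j, 0 <= c j &
    v = \sum_(j in t) c j *: (p j - p i)].

Definition row3 (R : realType) (q : R * R * R) : 'rV[R]_3 :=
  \row_(k < 3) [:: q.1.1; q.1.2; q.2]`_k.

Definition volume3 (R : realType) (A : set 'rV[R]_3) : R :=
  fine (((lebesgue_measure \x lebesgue_measure) \x lebesgue_measure)%E
    ((@row3 R) @^-1` A)).

(* The area cut out of the unit sphere by a cone is three times the volume of
   the part of the cone inside the unit ball. *)
Definition corner_solid_angle (R : realType) (N : nat) (t : {set 'I_N})
    (p : 'I_N -> 'rV[R]_3) (i : 'I_N) : R :=
  3 * volume3 (corner_cone t p i `&` [set v : 'rV[R]_3 | enorm v <= 1]).

(* The solid angle does not depend on the chosen placement, since two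
   placements with the same edge lengths differ by an isometry. *)
Definition solid_angle (R : realType) (N : nat) (r : 'rV[R]_N)
    (t : {set 'I_N}) (i : 'I_N) : R :=
  get [set a | exists2 p, tetra_placement r t p & a = corner_solid_angle t p i].

Definition curvature (R : realType) (N : nat) (T : {set {set 'I_N}})
    (r : 'rV[R]_N) (i : 'I_N) : R :=
  4 * pi - \sum_(t in T | i \in t) solid_angle r t i.

Definition scalar_curvature (R : realType) (N : nat) (T : {set {set 'I_N}})
    (r : 'rV[R]_N) (i : 'I_N) : R :=
  curvature T r i / r 0 i ^+ 2.

Definition nonpositive_constant_curvature (R : realType) (N : nat)
    (T : {set {set 'I_N}}) : set 'rV[R]_N :=
  [set r : 'rV[R]_N | exists2 lambda : R, lambda <= 0 &
    forall i, scalar_curvature T r i = lambda].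

(* (\sum_i r_i^3)^(1/3) = 1 with the cube root removed: the library power
   [`^] takes junk values at negative arguments. *)
Definition unit_sphere3 (R : realType) (N : nat) : set 'rV[R]_N :=
  [set r : 'rV[R]_N | \sum_i r 0 i ^+ 3 = 1].
Arguments unit_sphere3 R N : clear implicits.

(* Main.v *)
(* In terms of the curvatures [k_i = 1 / r_i] of the four spheres of a
   tetrahedron, put [t = sum k_i] and [Q = t^2 - 2 sum k_i^2].  The dihedral
   angle at an edge is the sum of [atan ((t - 2 k_j) / sqrt Q)] over the two
   vertices [j] off the edge, so Girard's formula makes the solid angles
   explicit.  They satisfy [sum r_i d alpha_i = 0] (Schlaefli), and
   [- sum d alpha_i d r_i] is a positive multiple of a quadratic form in the
   variables [r_i d alpha_i], definite on the hyperplane [sum = 0].  Hence along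
   a segment of sphere packing metrics from [s] to [r]
     [sum_i (K_i(r) - K_i(s)) (r_i - s_i) >= 0],
   with equality only if [r] and [s] are proportional on every tetrahedron, and
   so everywhere, since the manifold is connected.  If [K(r) = la r^2] and
   [K(s) = mu s^2] with [la, mu <= 0] and [sum r_i^3 = sum s_i^3 = 1], then the
   left-hand side is
     [la (1 - sum r_i^2 s_i) + mu (1 - sum s_i^2 r_i) <= 0]
   by the inequality of arithmetic and geometric means, so [r = s]. *)

(* The condition Q > 0 is not convex in the radii, so a segment between two sphere packing metrics
   may leave the domain; hence the result is local, the neighborhood being a ball on which Q stays
   positive. Along the segment no tetrahedron is placed in space: the angles enter through the
   explicit [corner_angle], for which Q > 0 suffices, and placements are used only at the two ends.

   In the increments of the radii the form is merely semidefinite, because scaling fixes all angles.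
   The variables r_i d alpha_i remove exactly this direction, turn Schlaefli's formula into a linear
   constraint, and leave a 3 by 3 Sylvester test whose determinant is a positive multiple of Q.

   Since solid angles are defined by Lebesgue volume, Girard's formula has to be derived from
   integrals: area of a planar sector, then volume of a wedge of the ball by slicing, then a
   corner. *)
Require Import Defs.
From HB Require Import structures.
From mathcomp Require Import all_boot all_order all_algebra ring lra.
From mathcomp Require Import all_classical all_reals all_analysis.
From mathcomp Require Import measurable_realfun.
Import Order.TTheory GRing.Theory Num.Theory.
Import numFieldNormedType.Exports.
Local Open Scope classical_set_scope.
Local Open Scope ring_scope.

Set Implicit Arguments.
Unset Strict Implicit.
Unset Printing Implicit Defensive.

(** * The quadratic form of a tetrahedron *)

(** Completing squares: [m11 * D2] times the form is a sum of three squares with positive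
    coefficients, so a nonpositive value kills [w], then [v], then [u]. *)
Lemma sylvester3 (R : realFieldType) (m11 m12 m13 m22 m23 m33 u v w : R) :
  0 < m11 -> 0 < m11 * m22 - m12 ^+ 2 ->
  0 < m11 * (m22 * m33 - m23 ^+ 2) - m12 * (m12 * m33 - m13 * m23)
      + m13 * (m12 * m23 - m13 * m22) ->
  m11 * u ^+ 2 + m22 * v ^+ 2 + m33 * w ^+ 2
    + 2 * (m12 * u * v + m13 * u * w + m23 * v * w) <= 0 ->
  [/\ u = 0, v = 0 & w = 0].
Proof.
set D2 := m11 * m22 - m12 ^+ 2 => m0 D20; set D3 := (X in 0 < X) => D30.
set f := (X in X <= 0) => f0.
pose p := m11 * u + m12 * v + m13 * w.
pose q := D2 * v + (m11 * m23 - m12 * m13) * w.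
have fE : m11 * D2 * f = D2 * p ^+ 2 + q ^+ 2 + m11 * D3 * w ^+ 2.
  by rewrite /f /p /q /D2 /D3; ring.
have f_le0 : m11 * D2 * f <= 0 by rewrite mulr_ge0_le0// ltW// mulr_gt0.
have h1 : 0 <= D2 * p ^+ 2 by rewrite mulr_ge0 ?sqr_ge0// ltW.
have h2 : 0 <= q ^+ 2 by exact: sqr_ge0.
have m11D3 : 0 < m11 * D3 by rewrite mulr_gt0.
have h3 : 0 <= m11 * D3 * w ^+ 2 by rewrite mulr_ge0 ?sqr_ge0// ltW.
have /eqP : m11 * D3 * w ^+ 2 = 0 by lra.
rewrite mulf_eq0 (gt_eqF m11D3)/= sqrf_eq0 => /eqP w0.
have /eqP : q ^+ 2 = 0 by lra.
rewrite sqrf_eq0 /q w0 mulr0 addr0 mulf_eq0 (gt_eqF D20)/= => /eqP v0.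
have /eqP : D2 * p ^+ 2 = 0 by lra.
rewrite mulf_eq0 (gt_eqF D20)/= sqrf_eq0 /p w0 v0 !mulr0 !addr0.
by rewrite mulf_eq0 (gt_eqF m0)/= => /eqP u0.
Qed.

(** For the curvatures of three mutually tangent spheres, the squared curvature of the incircle of
    the triangle of centres. *)
Definition elem2 {R : realFieldType} (a b c : R) := a * b + b * c + c * a.

(** This is 4 / rho^2 for the radius rho of the sphere tangent to all six edges. That sphere meets
    each face in its incircle; Pythagoras then reads [4 * elem2 b c d = Q + (s - 2 * a) ^+ 2], where
    [s = a + b + c + d]. *)
Definition packQ {R : realFieldType} (a b c d : R) :=
  (a + b + c + d) ^+ 2 - 2 * (a ^+ 2 + b ^+ 2 + c ^+ 2 + d ^+ 2).

Lemma elem2_gt0 (R : realFieldType) (a b c : R) :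
  0 < a -> 0 < b -> 0 < c -> 0 < elem2 a b c.
Proof. by move=> *; rewrite !addr_gt0 ?mulr_gt0. Qed.

(* The leading minors of the form of [dual_form_definite] in the coordinates
   [x, y, z], with [w = - x - y - z] eliminated. *)
Lemma minor1_gt0 (R : realFieldType) (a b c d : R) :
  0 < a -> 0 < b -> 0 < c -> 0 < d -> 0 < packQ a b c d ->
  0 < 2 * elem2 b c d + 2 * elem2 a b c
      + a * b * c * d * (a^-1 - d^-1) ^+ 2 - 2 / 3 * (a - d) ^+ 2.
Proof.
rewrite /packQ => a0 b0 c0 d0 Q0.
have h : 0 <= a * b * c * d * (a^-1 - d^-1) ^+ 2.
  by rewrite mulr_ge0 ?sqr_ge0 ?mulr_ge0 ?ltW.
have h1 : 0 < a * b by rewrite mulr_gt0.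
have h2 : 0 < b * c by rewrite mulr_gt0.
have h3 : 0 < c * a by rewrite mulr_gt0.
have h4 : 0 < c * d by rewrite mulr_gt0.
have h5 : 0 < b * d by rewrite mulr_gt0.
(* The difference of the two sides is [packQ a b c d + (b - c) ^+ 2]. *)
have h6 : (a - d) ^+ 2 < 2 * (a + d) * (b + c).
  by have := sqr_ge0 (b - c); lra.
rewrite /elem2; lra.
Qed.

(** Sorted by powers of [c]; [G] is [packQ] at [c = 0]. *)
Lemma minor2_eq (R : realFieldType) (a b c d : R) :
  a != 0 -> b != 0 -> c != 0 -> d != 0 ->
  let e1 := a + b + d in
  let e2 := elem2 a b d in
  let e3 := a * b * d in
  let G := 2 * e2 - (a ^+ 2 + b ^+ 2 + d ^+ 2) in
  let Pi := a * b * c * d in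
  let sa := a^-1 - d^-1 in let sb := b^-1 - d^-1 in
  let ta := a - d in let tb := b - d in
  let E4 := elem2 a b c in
  let m11 := 2 * elem2 b c d + 2 * E4 + Pi * sa ^+ 2 - 2 / 3 * ta ^+ 2 in
  let m22 := 2 * elem2 a c d + 2 * E4 + Pi * sb ^+ 2 - 2 / 3 * tb ^+ 2 in
  let m12 := 2 * E4 + Pi * sa * sb - 2 / 3 * ta * tb in
  m11 * m22 - m12 ^+ 2 = 2 / 3 * e2 / e3 *
   (2 * e3 * G + c * (e2 * G + 5 * e3 * e1) + 3 * c ^+ 2 * (e1 * e2 - e3)).
Proof.
by move=> a0 b0 c0 d0 /=; rewrite /elem2; field; rewrite a0 b0 ?c0 d0.
Qed.

(** All factors besides [packQ] are positive for positive arguments, so positivity of Q is precisely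
    what the last minor requires. *)
Lemma minor3_eq (R : realFieldType) (a b c d : R) :
  a != 0 -> b != 0 -> c != 0 -> d != 0 ->
  let Pi := a * b * c * d in
  let sa := a^-1 - d^-1 in let sb := b^-1 - d^-1 in let sc := c^-1 - d^-1 in
  let ta := a - d in let tb := b - d in let tc := c - d in
  let E4 := elem2 a b c in
  let m11 := 2 * elem2 b c d + 2 * E4 + Pi * sa ^+ 2 - 2 / 3 * ta ^+ 2 in
  let m22 := 2 * elem2 a c d + 2 * E4 + Pi * sb ^+ 2 - 2 / 3 * tb ^+ 2 in
  let m33 := 2 * elem2 a b d + 2 * E4 + Pi * sc ^+ 2 - 2 / 3 * tc ^+ 2 in
  let m12 := 2 * E4 + Pi * sa * sb - 2 / 3 * ta * tb in
  let m13 := 2 * E4 + Pi * sa * sc - 2 / 3 * ta * tc in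
  let m23 := 2 * E4 + Pi * sb * sc - 2 / 3 * tb * tc in
  m11 * (m22 * m33 - m23 ^+ 2) - m12 * (m12 * m33 - m13 * m23)
      + m13 * (m12 * m23 - m13 * m22) =
  4 / 3 * packQ a b c d / Pi *
   (elem2 b c d * elem2 a c d * elem2 a b d * elem2 a b c).
Proof.
by move=> a0 b0 c0 d0 /=; rewrite /elem2 /packQ; field; rewrite a0 b0 c0 d0.
Qed.

Lemma minor2_gt0 (R : realFieldType) (a b c d : R) :
  0 < a -> 0 < b -> 0 < c -> 0 < d -> 0 < packQ a b c d ->
  let e1 := a + b + d in
  let e2 := elem2 a b d in
  let e3 := a * b * d in
  let G := 2 * e2 - (a ^+ 2 + b ^+ 2 + d ^+ 2) in
  (0 < 2 * e3 * G + c * (e2 * G + 5 * e3 * e1) + 3 * c ^+ 2 * (e1 * e2 - e3)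
   : Prop).
Proof.
move=> a0 b0 c0 d0 Q0 e1 e2 e3 G.
have e1_gt0 : 0 < e1 by rewrite !addr_gt0.
have e2_gt0 : 0 < e2 by exact: elem2_gt0.
have e3_gt0 : 0 < e3 by rewrite !mulr_gt0.
have e12 : 0 < e1 * e2 - e3.
  have : 0 < a * elem2 a b d + b * elem2 a b d + d * (b * d + d * a).
    by rewrite !addr_gt0// ?mulr_gt0// ?elem2_gt0// addr_gt0// mulr_gt0.
  by rewrite /e1 /e2 /e3 /elem2; lra.
(* [G] can be negative; substituting [G = packQ a b c d - 2 * c * e1 + c ^+ 2] leaves only positive
   terms. *)
have -> : 2 * e3 * G + c * (e2 * G + 5 * e3 * e1) + 3 * c ^+ 2 * (e1 * e2 - e3)
    = (2 * e3 + c * e2) * packQ a b c d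
      + c * (e2 * c ^+ 2 + c * (e1 * e2 - e3) + e3 * e1).
  by rewrite /packQ /G /e1 /e2 /e3 /elem2; ring.
apply: addr_gt0; first by rewrite mulr_gt0// addr_gt0// mulr_gt0// mulr_gt0.
by rewrite mulr_gt0// !addr_gt0// mulr_gt0// exprn_gt0.
Qed.

Lemma dual_form_definite (R : realFieldType) (a b c d x y z w : R) :
  0 < a -> 0 < b -> 0 < c -> 0 < d -> 0 < packQ a b c d ->
  x + y + z + w = 0 ->
  2 * (elem2 b c d * x ^+ 2 + elem2 a c d * y ^+ 2 + elem2 a b d * z ^+ 2
       + elem2 a b c * w ^+ 2)
    + a * b * c * d * (x / a + y / b + z / c + w / d) ^+ 2
    - 2 / 3 * (a * x + b * y + c * z + d * w) ^+ 2 <= 0 ->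
  [/\ x = 0, y = 0, z = 0 & w = 0].
Proof.
move=> a0 b0 c0 d0 Q0 s0; have -> : w = - x - y - z by lra.
set E1 := elem2 b c d; set E2 := elem2 a c d; set E3 := elem2 a b d.
set E4 := elem2 a b c; set f := (X in X <= 0) => f0.
have an0 := lt0r_neq0 a0; have bn0 := lt0r_neq0 b0.
have cn0 := lt0r_neq0 c0; have dn0 := lt0r_neq0 d0.
pose Pi := a * b * c * d.
(* Coefficients of the two linear forms after eliminating [w]; the square of [w] itself contributes
   [2 * E4] to every matrix entry. *)
pose sa := a^-1 - d^-1; pose sb := b^-1 - d^-1; pose sc := c^-1 - d^-1.
pose ta := a - d; pose tb := b - d; pose tc := c - d.
pose m11 := 2 * E1 + 2 * E4 + Pi * sa ^+ 2 - 2 / 3 * ta ^+ 2.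
pose m22 := 2 * E2 + 2 * E4 + Pi * sb ^+ 2 - 2 / 3 * tb ^+ 2.
pose m33 := 2 * E3 + 2 * E4 + Pi * sc ^+ 2 - 2 / 3 * tc ^+ 2.
pose m12 := 2 * E4 + Pi * sa * sb - 2 / 3 * ta * tb.
pose m13 := 2 * E4 + Pi * sa * sc - 2 / 3 * ta * tc.
pose m23 := 2 * E4 + Pi * sb * sc - 2 / 3 * tb * tc.
have fE : f = m11 * x ^+ 2 + m22 * y ^+ 2 + m33 * z ^+ 2
              + 2 * (m12 * x * y + m13 * x * z + m23 * y * z).
  rewrite /f /m11 /m22 /m33 /m12 /m13 /m23 /sa /sb /sc /ta /tb /tc /Pi.
  by field; rewrite an0 bn0 cn0 dn0.
suff [-> -> ->] : [/\ x = 0, y = 0 & z = 0] by split=> //; rewrite !subr0 oppr0.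
apply: (@sylvester3 R m11 m12 m13 m22 m23 m33).
- exact: minor1_gt0.
- rewrite [X in 0 < X]minor2_eq//; apply: mulr_gt0; last exact: minor2_gt0.
  by rewrite !(mulr_gt0, invr_gt0, elem2_gt0).
- rewrite [X in 0 < X]minor3_eq//; apply: mulr_gt0.
    by rewrite !(mulr_gt0, invr_gt0).
  by rewrite !(mulr_gt0, elem2_gt0).
- by rewrite -fE.
Qed.

(* [da, ..., dd] are increments of the curvatures, [ta, ..., td] the resulting
   increments of the face angles and [q = sqrt Q].  The form on the left is
   [q / Q] times that of [dual_form_definite] at [x = (tb + tc + td) / a] and so
   on. *)
Lemma energy_form_definite (R : realFieldType)
    (a b c d da db dc dd ta tb tc td q : R) :
  0 < a -> 0 < b -> 0 < c -> 0 < d -> 0 < packQ a b c d -> 0 < q ->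
  let s := a + b + c + d in
  let Q := packQ a b c d in
  let S := da + db + dc + dd in
  let L := (s - 2 * a) * da + (s - 2 * b) * db
           + (s - 2 * c) * dc + (s - 2 * d) * dd in
  4 * q * elem2 b c d * ta = Q * (S - 2 * da) - (s - 2 * a) * L ->
  4 * q * elem2 a c d * tb = Q * (S - 2 * db) - (s - 2 * b) * L ->
  4 * q * elem2 a b d * tc = Q * (S - 2 * dc) - (s - 2 * c) * L ->
  4 * q * elem2 a b c * td = Q * (S - 2 * dd) - (s - 2 * d) * L ->
  (tb + tc + td) * da / a ^+ 2 + (ta + tc + td) * db / b ^+ 2
  + (ta + tb + td) * dc / c ^+ 2 + (ta + tb + tc) * dd / d ^+ 2 <= 0 ->
  [/\ Q * da = L * a, Q * db = L * b, Q * dc = L * c & Q * dd = L * d].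
Proof.
move=> a0 b0 c0 d0 Q0 q0 s Q S L Eta Etb Etc Etd.
set f := (X in X <= 0) => f0.
have an0 := lt0r_neq0 a0; have bn0 := lt0r_neq0 b0.
have cn0 := lt0r_neq0 c0; have dn0 := lt0r_neq0 d0; have qn0 := lt0r_neq0 q0.
have Qn0 := lt0r_neq0 Q0.
have Ean0 := lt0r_neq0 (elem2_gt0 b0 c0 d0).
have Ebn0 := lt0r_neq0 (elem2_gt0 a0 c0 d0).
have Ecn0 := lt0r_neq0 (elem2_gt0 a0 b0 d0).
have Edn0 := lt0r_neq0 (elem2_gt0 a0 b0 c0).
have solve (e t g : R) : e != 0 -> 4 * q * e * t = g -> t = g / (4 * q * e).
  by move=> e0 <-; field; rewrite qn0 e0.
have taE := solve _ _ _ Ean0 Eta; have tbE := solve _ _ _ Ebn0 Etb.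
have tcE := solve _ _ _ Ecn0 Etc; have tdE := solve _ _ _ Edn0 Etd.
pose x := (tb + tc + td) / a; pose y := (ta + tc + td) / b.
pose z := (ta + tb + td) / c; pose w := (ta + tb + tc) / d.
(* Schlaefli's formula: [2 * x] is the radius times the increment of the solid angle. *)
have sum0 : x + y + z + w = 0.
  rewrite /x /y /z /w taE tbE tcE tdE /L /S /Q /s /packQ.
  move: Ean0 Ebn0 Ecn0 Edn0; rewrite /elem2 => *; field.
  by rewrite ?an0 ?bn0 ?cn0 ?dn0 ?qn0 ?Qn0; do ?[apply/andP; split].
have fE : Q * f = q *
    (2 * (elem2 b c d * x ^+ 2 + elem2 a c d * y ^+ 2 + elem2 a b d * z ^+ 2
          + elem2 a b c * w ^+ 2)
     + a * b * c * d * (x / a + y / b + z / c + w / d) ^+ 2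
     - 2 / 3 * (a * x + b * y + c * z + d * w) ^+ 2).
  rewrite /f /x /y /z /w taE tbE tcE tdE /L /S /Q /s /packQ.
  move: Ean0 Ebn0 Ecn0 Edn0; rewrite /elem2 => *; field.
  by rewrite ?an0 ?bn0 ?cn0 ?dn0 ?qn0 ?Qn0; do ?[apply/andP; split].
have [x0 y0 z0 w0] : [/\ x = 0, y = 0, z = 0 & w = 0].
  apply: (@dual_form_definite R a b c d) => //.
  by rewrite -(pmulr_rle0 _ q0) -fE pmulr_rle0.
have mul0 (k t : R) : k != 0 -> t / k = 0 -> t = 0.
  by move=> k0 /eqP; rewrite mulf_eq0 invr_eq0 (negbTE k0) orbF => /eqP.
have {}x0 := mul0 _ _ an0 x0; have {}y0 := mul0 _ _ bn0 y0.
have {}z0 := mul0 _ _ cn0 z0; have {}w0 := mul0 _ _ dn0 w0.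
have [ta0 tb0 tc0 td0] : [/\ ta = 0, tb = 0, tc = 0 & td = 0].
  by clear -x0 y0 z0 w0; split; lra.
(* With vanishing angle increments the four equations add up to [Q * S = s * L], and each then
   becomes [Q * da = L * a]: the increment is a scaling. *)
move: Eta Etb Etc Etd; rewrite ta0 tb0 tc0 td0 !mulr0.
by clearbody Q L; clear; rewrite /S /s; move=> *; split; lra.
Qed.

(** Follows from definiteness: a negative value would make the increments proportional to the
    curvatures, hence all angle increments zero, hence the value zero. *)
Lemma energy_form_ge0 (R : realFieldType)
    (a b c d da db dc dd ta tb tc td q : R) :
  0 < a -> 0 < b -> 0 < c -> 0 < d -> 0 < packQ a b c d -> 0 < q ->
  let s := a + b + c + d in
  let Q := packQ a b c d in
  let S := da + db + dc + dd in
  let L := (s - 2 * a) * da + (s - 2 * b) * db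
           + (s - 2 * c) * dc + (s - 2 * d) * dd in
  4 * q * elem2 b c d * ta = Q * (S - 2 * da) - (s - 2 * a) * L ->
  4 * q * elem2 a c d * tb = Q * (S - 2 * db) - (s - 2 * b) * L ->
  4 * q * elem2 a b d * tc = Q * (S - 2 * dc) - (s - 2 * c) * L ->
  4 * q * elem2 a b c * td = Q * (S - 2 * dd) - (s - 2 * d) * L ->
  (0 <= (tb + tc + td) * da / a ^+ 2 + (ta + tc + td) * db / b ^+ 2
    + (ta + tb + td) * dc / c ^+ 2 + (ta + tb + tc) * dd / d ^+ 2 : Prop).
Proof.
move=> a0 b0 c0 d0 Q0 q0 s Q S L Eta Etb Etc Etd.
set f := (X in 0 <= X); have [//|f0] := leP 0 f.
have [ea eb ec ed] :
    [/\ Q * da = L * a, Q * db = L * b, Q * dc = L * c & Q * dd = L * d].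
  exact: (@energy_form_definite R a b c d da db dc dd ta tb tc td q
    a0 b0 c0 d0 Q0 q0 Eta Etb Etc Etd (ltW f0)).
have SQ : Q * S = L * s.
  transitivity (Q * da + Q * db + Q * dc + Q * dd); first by rewrite /S; ring.
  by rewrite ea eb ec ed /s; ring.
have t0 (x y z k dk t : R) : 0 < x -> 0 < y -> 0 < z -> Q * dk = L * k ->
    4 * q * elem2 x y z * t = Q * (S - 2 * dk) - (s - 2 * k) * L -> t = 0.
  move=> x0 y0 z0 ek e.
  have /eqP : 4 * q * elem2 x y z * t = 0.
    rewrite e (_ : _ - _ = Q * S - 2 * (Q * dk) - (s - 2 * k) * L);
      last by ring.
    by rewrite SQ ek; ring.
  have p0 : 4 * q * elem2 x y z != 0.
    by rewrite gt_eqF// !mulr_gt0// elem2_gt0.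
  by rewrite mulf_eq0 (negbTE p0) => /eqP.
have f_eq0 : f = 0.
  rewrite /f (t0 _ _ _ _ _ _ b0 c0 d0 ea Eta) (t0 _ _ _ _ _ _ a0 c0 d0 eb Etb).
  rewrite (t0 _ _ _ _ _ _ a0 b0 d0 ec Etc) (t0 _ _ _ _ _ _ a0 b0 c0 ed Etd).
  by rewrite !addr0 !mul0r !addr0.
by rewrite f_eq0 ltxx in f0.
Qed.

(* For a face of the tetrahedron, opposite to the sphere of curvature [k], the
   angle between the face and the plane through one of its edges and the centre
   of the sphere tangent to all six edges; it is the same for the three edges
   and negative if the centre lies beyond the face. *)
Definition face_angle {R : realType} (s Q k : R) : R :=
  atan ((s - 2 * k) / Num.sqrt Q).

(* The solid angle at the vertex of radius [x], one of the radii [a, b, c, d]: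
   each face through the vertex contributes to the dihedral angles at two of the
   three edges there. *)
Definition corner_angle {R : realType} (a b c d x : R) : R :=
  let th := face_angle (a^-1 + b^-1 + c^-1 + d^-1) (packQ a^-1 b^-1 c^-1 d^-1)
    in
  2 * (th a^-1 + th b^-1 + th c^-1 + th d^-1 - th x^-1) - pi.

(** * Derivatives of the angles and monotonicity along a segment *)

Lemma is_derive_face_angle (R : realType) (s Q k : R -> R) (t ds dQ dk : R) :
  0 < Q t -> is_derive t 1 s ds -> is_derive t 1 Q dQ -> is_derive t 1 k dk ->
  is_derive t 1 (fun u => face_angle (s u) (Q u) (k u))
    ((2 * Q t * (ds - 2 * dk) - (s t - 2 * k t) * dQ)
     / (2 * Num.sqrt (Q t) * (Q t + (s t - 2 * k t) ^+ 2))).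
Proof.
move=> Q0 hs hQ hk; set q := Num.sqrt (Q t).
have q0 : 0 < q by rewrite sqrtr_gt0.
have qn0 := lt0r_neq0 q0.
have Qq : Q t = q ^+ 2 by rewrite sqr_sqrtr// ltW.
have hq : is_derive t 1 (fun u => Num.sqrt (Q u)) ((2 * q)^-1 * dQ).
  exact: is_derive1_comp (is_derive1_sqrt Q0) hQ.
have hqV : is_derive t 1 (fun u => (Num.sqrt (Q u))^-1)
    (- q ^- 2 *: ((2 * q)^-1 * dQ)) by apply: is_deriveV.
have hx : is_derive t 1 (fun u => s u - 2 * k u) (ds - 2 * dk).
  have h2k := @is_deriveM R _ (cst 2) k t 1 _ _ (is_derive_cst _ _ _) hk.
  apply: (is_derive_eq (is_deriveB hs h2k)).
  by rewrite /= /GRing.scale/= mulr0 addr0.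
have hM := @is_deriveM R _ _ _ _ _ _ _ hx hqV.
have hA := @is_derive1_comp R atan _ _ _ _ (is_derive1_atan _) hM.
apply: (is_derive_eq hA).
rewrite /= /GRing.scale/= -/q Qq.
have h : q ^+ 2 + (s t - 2 * k t) ^+ 2 != 0.
  by rewrite gt_eqF// ltr_pwDl// ?sqr_ge0// exprn_gt0.
rewrite -[X in 1 + X ^+ 2]/((s t - 2 * k t) / q).
by field; rewrite qn0 h.
Qed.

Lemma is_derive_packing_face_angle (R : realType) (a b c d x : R -> R)
    (t da db dc dd dx : R) :
  0 < packQ (a t) (b t) (c t) (d t) ->
  is_derive t 1 a da -> is_derive t 1 b db -> is_derive t 1 c dc ->
  is_derive t 1 d dd -> is_derive t 1 x dx ->
  let s := a t + b t + c t + d t in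
  let Q := packQ (a t) (b t) (c t) (d t) in
  let L := (s - 2 * a t) * da + (s - 2 * b t) * db + (s - 2 * c t) * dc
           + (s - 2 * d t) * dd in
  is_derive t 1
    (fun u => face_angle (a u + b u + c u + d u)
                         (packQ (a u) (b u) (c u) (d u)) (x u))
    ((Q * (da + db + dc + dd - 2 * dx) - (s - 2 * x t) * L)
     / (Num.sqrt Q * (Q + (s - 2 * x t) ^+ 2))).
Proof.
move=> Q0 ha hb hc hd hx s Q L.
have hs : is_derive t 1 (fun u => a u + b u + c u + d u) (da + db + dc + dd).
  exact: is_deriveD (is_deriveD (is_deriveD ha hb) hc) hd.
(* [L] is half the differential of Q, which cancels the 2 in the general formula. *)
have hQ : is_derive t 1 (fun u => packQ (a u) (b u) (c u) (d u)) (2 * L).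
  have hsq (f : R -> R) df : is_derive t 1 f df ->
      is_derive t 1 (fun u => f u ^+ 2) (2 * f t * df).
    move=> hf; apply: (is_derive_eq (is_deriveM hf hf)).
    by rewrite /GRing.scale/=; ring.
  have hp2 := is_deriveD (is_deriveD (is_deriveD (hsq _ _ ha) (hsq _ _ hb))
    (hsq _ _ hc)) (hsq _ _ hd).
  have := is_deriveB (hsq _ _ hs) (is_deriveM (is_derive_cst (2 : R) t 1) hp2).
  move=> /is_derive_eq; apply.
  by rewrite /GRing.scale/= /L /s; ring.
have q0 : 0 < Num.sqrt Q by rewrite sqrtr_gt0.
have hth := @is_derive_face_angle R _ (fun u => packQ (a u) (b u) (c u) (d u))
  _ t _ _ _ Q0 hs hQ hx.
apply: (is_derive_eq hth); rewrite -/s -/Q.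
have h : Q + (s - 2 * x t) ^+ 2 != 0 by rewrite gt_eqF// ltr_pwDl// sqr_ge0.
have qn0 : Num.sqrt Q != 0 by rewrite gt_eqF.
by field; rewrite qn0 h.
Qed.

(** By the mean value theorem [X] is the derivative at a single point of the segment, where it
    equals -2 times the energy form; the sign and the case of equality are both read off there. *)
Lemma corner_angle_monotone (R : realType) (r1 r2 r3 r4 s1 s2 s3 s4 : R) :
  0 < r1 -> 0 < r2 -> 0 < r3 -> 0 < r4 ->
  0 < s1 -> 0 < s2 -> 0 < s3 -> 0 < s4 ->
  (forall u : R, 0 <= u <= 1 ->
    0 < packQ (s1 + u * (r1 - s1))^-1 (s2 + u * (r2 - s2))^-1
              (s3 + u * (r3 - s3))^-1 (s4 + u * (r4 - s4))^-1) ->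
  let A := corner_angle r1 r2 r3 r4 in
  let B := corner_angle s1 s2 s3 s4 in
  let X := (A r1 - B s1) * (r1 - s1) + (A r2 - B s2) * (r2 - s2)
           + (A r3 - B s3) * (r3 - s3) + (A r4 - B s4) * (r4 - s4) in
  X <= 0 /\
  (0 <= X -> [/\ r1 * s2 = r2 * s1, r1 * s3 = r3 * s1 & r1 * s4 = r4 * s1]).
Proof.
move=> r1p r2p r3p r4p s1p s2p s3p s4p Qp A B X.
pose p (r s u : R) := s + u * (r - s).
have p_gt0 (r s u : R) : 0 < r -> 0 < s -> 0 <= u <= 1 -> 0 < p r s u.
  move=> r0 s0 /andP[u0 u1]; have -> : p r s u = u * r + (1 - u) * s.
    by rewrite /p; ring.
  have [->|un0] := eqVneq u 0; first by rewrite mul0r add0r subr0 mul1r.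
  have u_gt0 : 0 < u by rewrite lt0r un0.
  by rewrite ltr_pwDl ?mulr_gt0// mulr_ge0 ?subr_ge0// ltW.
have p0 (r s : R) : p r s 0 = s by rewrite /p mul0r addr0.
have p1 (r s : R) : p r s 1 = r by rewrite /p mul1r addrC subrK.
have dp (r s u : R) : 0 < r -> 0 < s -> 0 <= u <= 1 ->
    is_derive u 1 (fun u => (p r s u)^-1) (- (r - s) / p r s u ^+ 2).
  move=> r0 s0 u01; have pn0 := lt0r_neq0 (p_gt0 _ _ _ r0 s0 u01).
  have hp : is_derive u 1 (p r s) (r - s).
    have := is_deriveD (is_derive_cst s u 1)
      (is_deriveM (is_derive_id u 1) (is_derive_cst (r - s) u 1)).
    by move=> /is_derive_eq; apply; rewrite /GRing.scale/=; ring.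
  apply: (is_derive_eq (is_deriveV pn0 hp)).
  by rewrite /GRing.scale/=; field.
pose P (x y : R) := fun u : R => corner_angle (p r1 s1 u) (p r2 s2 u) (p r3 s3
  u)
  (p r4 s4 u) (p x y u).
pose f (u : R) := P r1 s1 u * (r1 - s1) + P r2 s2 u * (r2 - s2)
     + P r3 s3 u * (r3 - s3) + P r4 s4 u * (r4 - s4).
have fE : f 1 - f 0 = X by rewrite /f /P !p0 !p1 /X /A /B; ring.
pose a u := (p r1 s1 u)^-1; pose b u := (p r2 s2 u)^-1.
pose c u := (p r3 s3 u)^-1; pose d u := (p r4 s4 u)^-1.
pose da u := - (r1 - s1) / p r1 s1 u ^+ 2.
pose db u := - (r2 - s2) / p r2 s2 u ^+ 2.
pose dc u := - (r3 - s3) / p r3 s3 u ^+ 2.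
pose dd u := - (r4 - s4) / p r4 s4 u ^+ 2.
pose Q u := packQ (a u) (b u) (c u) (d u).
pose s u := a u + b u + c u + d u.
pose L u := (s u - 2 * a u) * da u + (s u - 2 * b u) * db u
            + (s u - 2 * c u) * dc u + (s u - 2 * d u) * dd u.
pose th (x dx : R -> R) (u : R) := (Q u * (da u + db u + dc u + dd u - 2 * dx u)
  - (s u - 2 * x u) * L u) / (Num.sqrt (Q u) * (Q u + (s u - 2 * x u) ^+ 2)) :
      R.
pose al (x dx : R -> R) (u : R) : R :=
  2 * (th a da u + th b db u + th c dc u + th d dd u - th x dx u).
have dal (x : R -> R) (dx u : R) : 0 <= u <= 1 ->
    is_derive u 1 x dx ->
    is_derive u 1 (fun v => 2 * (face_angle (s v) (Q v) (a v)
      + face_angle (s v) (Q v) (b v) + face_angle (s v) (Q v) (c v)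
      + face_angle (s v) (Q v) (d v) - face_angle (s v) (Q v) (x v)) - pi)
     (2 * (th a da u + th b db u + th c dc u + th d dd u - th x (cst dx) u)).
  move=> u01 hx.
  have ha : is_derive u 1 a (da u) by exact: dp.
  have hb : is_derive u 1 b (db u) by exact: dp.
  have hc : is_derive u 1 c (dc u) by exact: dp.
  have hd : is_derive u 1 d (dd u) by exact: dp.
  have dth y dy := @is_derive_packing_face_angle R a b c d y u _ _ _ _ dy
    (Qp u u01) ha hb hc hd.
  have := is_deriveB (is_deriveM (is_derive_cst (2 : R) u 1)
   (is_deriveB (is_deriveD (is_deriveD (is_deriveD (dth _ _ ha) (dth _ _ hb))
     (dth _ _ hc)) (dth _ _ hd)) (dth _ _ hx))) (is_derive_cst (pi : R) u 1).
  move=> /is_derive_eq; apply.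
  by rewrite /GRing.scale/= mulr0 addr0 subr0.
pose df u := al a da u * (r1 - s1) + al b db u * (r2 - s2)
     + al c dc u * (r3 - s3) + al d dd u * (r4 - s4).
have hf (u : R) : 0 <= u <= 1 -> is_derive u 1 f (df u).
  move=> u01.
  have term (x y i : R) : 0 < x -> 0 < y -> is_derive u 1 (fun v => P x y v * i)
     (al (fun u => (p x y u)^-1) (fun u => - (x - y) / p x y u ^+ 2) u * i).
    move=> x0 y0.
    have := is_deriveM (dal _ _ u u01 (dp _ _ _ x0 y0 u01)) (is_derive_cst i u
      1).
    by move=> /is_derive_eq; apply; rewrite /GRing.scale/= mulr0 add0r mulrC.
  exact: is_deriveD (is_deriveD (is_deriveD (term _ _ _ r1p s1p)
    (term _ _ _ r2p s2p)) (term _ _ _ r3p s3p)) (term _ _ _ r4p s4p).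
have [||u] := @MVT_segment R f df 0 1 ler01.
- by move=> u; rewrite in_itv/= => /andP[u0 u1]; apply: hf; rewrite !ltW.
- apply: derivable_within_continuous => u; rewrite in_itv/= => u01.
  by have [] := hf _ u01.
rewrite in_itv/= => u01; rewrite fE subr0 mulr1 => ->.
have A0 := p_gt0 _ _ _ r1p s1p u01; have B0 := p_gt0 _ _ _ r2p s2p u01.
have C0 := p_gt0 _ _ _ r3p s3p u01; have D0 := p_gt0 _ _ _ r4p s4p u01.
have Q0 : 0 < Q u by exact: Qp.
have q0 : 0 < Num.sqrt (Q u) by rewrite sqrtr_gt0.
have den (x dx : R -> R) (y z w : R) : s u = x u + y + z + w ->
    Q u = packQ (x u) y z w ->
    4 * Num.sqrt (Q u) * elem2 y z w * th x dx u =
    Q u * (da u + db u + dc u + dd u - 2 * dx u) - (s u - 2 * x u) * L u.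
  move=> sE QE; rewrite /th.
  have e : 4 * elem2 y z w = Q u + (s u - 2 * x u) ^+ 2.
    by rewrite QE sE /packQ /elem2; ring.
  have e0 : Q u + (s u - 2 * x u) ^+ 2 != 0.
    by rewrite gt_eqF// ltr_pwDl// sqr_ge0.
  rewrite (mulrAC 4) e; field.
  by rewrite (lt0r_neq0 q0) e0.
(* A solid angle is twice the sum of three face angles, up to a constant, and
   [r - s = - da / a ^+ 2] since [a] is the inverse radius. *)
have E0 : df u = - 2 * ((th b db u + th c dc u + th d dd u) * da u / a u ^+ 2
  + (th a da u + th c dc u + th d dd u) * db u / b u ^+ 2
  + (th a da u + th b db u + th d dd u) * dc u / c u ^+ 2
  + (th a da u + th b db u + th c dc u) * dd u / d u ^+ 2).
  rewrite /df /al.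
  generalize (th a da u) (th b db u) (th c dc u) (th d dd u) => ta tb tc td.
  rewrite /da /db /dc /dd /a /b /c /d; field.
  by rewrite !gt_eqF.
have dena := den a da (b u) (c u) (d u) erefl erefl.
have [sb Qb] : s u = b u + a u + c u + d u /\ Q u = packQ (b u) (a u) (c u) (d
  u).
  by rewrite /s /Q /packQ; split; ring.
have denb := den b db _ _ _ sb Qb.
have [sc Qc] : s u = c u + a u + b u + d u /\ Q u = packQ (c u) (a u) (b u) (d
  u).
  by rewrite /s /Q /packQ; split; ring.
have denc := den c dc _ _ _ sc Qc.
have [sd Qd] : s u = d u + a u + b u + c u /\ Q u = packQ (d u) (a u) (b u) (c
  u).
  by rewrite /s /Q /packQ; split; ring.
have dend := den d dd _ _ _ sd Qd.
have [a0 b0 c0 d0] : [/\ 0 < a u, 0 < b u, 0 < c u & 0 < d u] by rewrite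
  !invr_gt0.
split.
  have := energy_form_ge0 a0 b0 c0 d0 Q0 q0 dena denb denc dend.
  by rewrite E0; lra.
move=> df0; have F0 := energy_form_definite a0 b0 c0 d0 Q0 q0 dena denb denc
  dend.
have [|Ea Eb Ec Ed] := F0; first by move: df0; rewrite E0; lra.
(* The increments are proportional to the radii at the intermediate point; in the cross difference
   the terms containing [u] cancel, which leaves proportionality of the end points. *)
have prop (x y x' y' : R) : 0 < p x y u -> 0 < p x' y' u ->
    Q u * (- (x - y) / p x y u ^+ 2) = L u * (p x y u)^-1 ->
    Q u * (- (x' - y') / p x' y' u ^+ 2) = L u * (p x' y' u)^-1 ->
    x * y' = x' * y.
  move=> X0 Y0 h1 h2.
  have g1 : - Q u * (x - y) = L u * p x y u.
    transitivity (Q u * (- (x - y) / p x y u ^+ 2) * p x y u ^+ 2).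
      by field; rewrite gt_eqF.
    by rewrite h1; field; rewrite gt_eqF.
  have g2 : - Q u * (x' - y') = L u * p x' y' u.
    transitivity (Q u * (- (x' - y') / p x' y' u ^+ 2) * p x' y' u ^+ 2).
      by field; rewrite gt_eqF.
    by rewrite h2; field; rewrite gt_eqF.
  have : - Q u * ((x - y) * p x' y' u - (x' - y') * p x y u) = 0.
    by rewrite mulrBr !mulrA g1 g2; ring.
  move=> /eqP; rewrite mulf_eq0 oppr_eq0 (gt_eqF Q0)/= => /eqP.
  by rewrite /p => h; apply/eqP; rewrite -subr_eq0; apply/eqP; rewrite -h; ring.
by split; [exact: prop Ea Eb|exact: prop Ea Ec|exact: prop Ea Ed].
Qed.

Local Notation leb := lebesgue_measure.

(** * Lebesgue measure in the plane and in space *)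

Section area.
Context {R : realType}.
Local Notation T := (measurableTypeR R).

(* A fresh name for the product measure: on [_ \x _] itself, inference of a
   sigma-finite structure only succeeds for subprobabilities. *)
Definition area : set (T * T) -> \bar R := (leb \x leb)%E.

HB.instance Definition _ := Measure.on area.

Let area_sigma_finite : sigma_finite [set: T * T] area.
Proof.
have /sigma_finiteP[F [TF ndF Foo]] := sigma_finiteT (@lebesgue_measure R).
exists (fun n => F n `*` F n).
  rewrite -setXTT TF predeqE => -[x y]; split.
    move=> [/= [n _ Fnx] [k _ Fky]]; exists (maxn n k) => //; split.
    - by move: x Fnx; exact/subsetPset/ndF/leq_maxl.
    - by move: y Fky; exact/subsetPset/ndF/leq_maxr.
  by move=> [n _ []/= ? ?]; split; exists n.
move=> k; have [? ?] := Foo k; split; first exact: measurableX.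
by rewrite /area product_measure1E// lte_mul_pinfty// ge0_fin_numE.
Qed.

HB.instance Definition _ :=
  Measure_isSigmaFinite.Build _ _ _ area area_sigma_finite.

Definition volume : set (T * T * T) -> \bar R := (area \x leb)%E.

HB.instance Definition _ := Measure.on volume.

Lemma area_xsection A : area A = (\int[leb]_x leb (xsection A x))%E.
Proof. by []. Qed.

(** Slicing in the other order gives a measure with the same values on rectangles, so uniqueness of
    the product measure applies. *)
Lemma area_ysection A : measurable A ->
  area A = (\int[leb]_y leb (ysection A y))%E.
Proof.
move=> mA; rewrite -[RHS]/((leb \x^ leb)%E A).
by apply: product_measure_unique => //= *; rewrite product_measure2E.
Qed.

Lemma volume_zsection A : measurable A ->
  volume A = (\int[leb]_z area (ysection A z))%E.
Proof.
move=> mA; rewrite -[RHS]/((area \x^ leb)%E A).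
by apply: product_measure_unique => //= *; rewrite product_measure2E.
Qed.

Lemma volume_xsection A : measurable A ->
  volume A = (\int[leb]_x area [set q | A ((x, q.1), q.2)])%E.
Proof.
move=> mA; rewrite -[LHS]/(\int[area]_p leb (xsection A p))%E.
by rewrite (@fubini_tonelli1 _ _ _ _ _ leb leb)//;
  exact: measurable_fun_xsection.
Qed.

End area.


(** * Affine changes of variable on the line and in the plane *)

Section affine_line.
Context {R : realType} (k t : R).
Context (k0 : k != 0).
Local Notation T := (measurableTypeR R).

Definition affine_fun : T -> T := fun x => k * x + t.

Lemma measurable_affine_fun : measurable_fun setT affine_fun.
Proof. by apply: measurable_funD => //; exact: measurable_funM. Qed.

(** Lebesgue measure is determined by half-open intervals, and the rescaled pushforward agrees with
    it on them. *)
Lemma lebesgue_measure_affine (A : set T) : measurable A ->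
  leb A = (`|k|%:E * leb (affine_fun @^-1` A))%E.
Proof.
move=> mA; pose nk := NngNum (normr_ge0 k).
pose m : {measure set T -> \bar R} :=
  mscale nk (pushforward leb affine_fun).
rewrite (@lebesgue_measure_unique R (m measurable_affine_fun))//.
move=> X [[a b] _ <-]; rewrite -[RHS]/(`|k|%:E * leb (affine_fun @^-1` `]a,
  b]))%E.
have [k_gt0|k_lt0|k_eq0] := ltgtP 0 k; last by move: k0; rewrite -k_eq0 eqxx.
- rewrite (_ : _ @^-1` _ = `](a - t) / k, (b - t) / k]%classic); last first.
    apply/seteqP; split=> x; rewrite /= !in_itv/= /affine_fun.
      by rewrite ltr_pdivrMr// ler_pdivlMr// ltrBlDr lerBrDr mulrC.
    by rewrite ltr_pdivrMr// ler_pdivlMr// ltrBlDr lerBrDr mulrC.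
  rewrite !lebesgue_measure_itv/= !lte_fin ltr_pM2r ?invr_gt0// ltrD2r.
  case: ifPn => // _; last by rewrite mule0.
  by rewrite -!EFinB -EFinM gtr0_norm//; congr EFin; field; rewrite gt_eqF.
(* A negative slope moves the closed end to the other side, without effect on the measure. *)
- rewrite (_ : _ @^-1` _ = `[(b - t) / k, (a - t) / k[%classic); last first.
    apply/seteqP; split=> x; rewrite /= !in_itv/= /affine_fun.
      by rewrite ler_ndivrMr// ltr_ndivlMr// ltrBlDr lerBrDr mulrC andbC.
    by rewrite ler_ndivrMr// ltr_ndivlMr// ltrBlDr lerBrDr mulrC andbC.
  rewrite !lebesgue_measure_itv/= !lte_fin ltr_nM2r ?invr_lt0// ltrD2r.
  case: ifPn => // _; last by rewrite mule0.
  by rewrite -!EFinB -EFinM ltr0_norm//; congr EFin; field; rewrite lt_eqF.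
Qed.

End affine_line.

Section plane_maps.
Context {R : realType}.
Local Notation T := (measurableTypeR R).

(** On each line parallel to the first axis this is an affine map of the line, so slicing yields its
    Jacobian; rotations factor into such maps. *)
Definition affine_fst (k h : R) (q : T * T) : T * T := (k * q.1 + h * q.2, q.2).

Definition affine_snd (k h : R) (q : T * T) : T * T := (q.1, k * q.2 + h * q.1).

Lemma measurable_affine_fst k h : measurable_fun setT (affine_fst k h).
Proof.
apply/measurable_fun_pairP; split=> /=; last exact: measurable_snd.
by apply: measurable_funD; exact: measurable_funM.
Qed.

Lemma measurable_affine_snd k h : measurable_fun setT (affine_snd k h).
Proof.
apply/measurable_fun_pairP; split=> /=; first exact: measurable_fst.
by apply: measurable_funD; exact: measurable_funM.
Qed.

Lemma area_affine_fst (k h : R) (A : set (T * T)) : k != 0 -> measurable A ->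
  area A = (`|k|%:E * area (affine_fst k h @^-1` A))%E.
Proof.
move=> k0 mA.
have mfA : measurable (affine_fst k h @^-1` A).
  by rewrite -[_ @^-1` _]setTI; exact: measurable_affine_fst.
rewrite !area_ysection// -ge0_integralZl//; last exact: measurable_fun_ysection.
apply: eq_integral => y _.
rewrite (@lebesgue_measure_affine R k (h * y))//.
exact: measurable_ysection.
Qed.

Lemma area_affine_snd (k h : R) (A : set (T * T)) : k != 0 -> measurable A ->
  area A = (`|k|%:E * area (affine_snd k h @^-1` A))%E.
Proof.
move=> k0 mA.
have mfA : measurable (affine_snd k h @^-1` A).
  by rewrite -[_ @^-1` _]setTI; exact: measurable_affine_snd.
rewrite !area_xsection -ge0_integralZl//; last exact: measurable_fun_xsection.
apply: eq_integral => x _.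
rewrite (@lebesgue_measure_affine R k (h * x))//.
exact: measurable_xsection.
Qed.

Lemma area_swap (A : set (T * T)) : measurable A ->
  area A = area ((fun q : T * T => (q.2, q.1)) @^-1` A).
Proof.
by move=> mA; rewrite area_ysection// area_xsection.
Qed.

Definition dot2 (p q : T * T) : R := p.1 * q.1 + p.2 * q.2.

(** Measure preservation is bundled in, so that maps composed from coordinate changes carry it
    along. *)
Definition plane_isometry (g : T * T -> T * T) :=
  [/\ measurable_fun setT g,
      forall A, measurable A -> area (g @^-1` A) = area A &
      forall p q, dot2 (g p) (g q) = dot2 p q].

Lemma plane_isometry_comp f g :
  plane_isometry f -> plane_isometry g -> plane_isometry (f \o g).
Proof.
move=> [mf vf df] [mg vg dg]; split; first exact: measurableT_comp.
- move=> A mA; rewrite comp_preimage vg ?vf//.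
  by rewrite -[_ @^-1` _]setTI; exact: mf.
- by move=> p q /=; rewrite df dg.
Qed.

Lemma affine_fst_isometry k : k ^+ 2 = 1 -> plane_isometry (affine_fst k 0).
Proof.
move=> k1; have k0 : k != 0.
  by apply/eqP => k0; move/eqP: k1; rewrite k0 expr0n eq_sym oner_eq0.
have nk : `|k| = 1.
  by apply/eqP; rewrite -(@eqrXn2 _ 2)// -normrX k1 normr1 expr1n.
split; first exact: measurable_affine_fst.
- by move=> A mA; rewrite [RHS](@area_affine_fst k 0)// nk mul1e.
- move=> p q; rewrite /dot2/= !mul0r !addr0.
  by rewrite mulrACA -expr2 k1 mul1r.
Qed.

Lemma swap_isometry : plane_isometry (fun q => (q.2, q.1)).
Proof.
split.
- by apply/measurable_fun_pairP; split;
    [exact: measurable_snd|exact: measurable_fst].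
- by move=> A mA; rewrite [RHS]area_swap.
- by move=> a b; rewrite /dot2/= addrC.
Qed.

(** A rotation with cosine [c != 0] is a product of two triangular maps with Jacobians [c] and
    [c^-1]. The excluded case, [p] on the second axis, is settled by a swap and a sign. *)
Lemma plane_rotation (p : T * T) :
  exists g, [/\ plane_isometry g, 0 <= (g p).1 & (g p).2 = 0].
Proof.
have [p10|p10] := eqVneq p.1 0.
  pose k : R := if 0 <= p.2 then 1 else -1.
  exists (affine_fst k 0 \o (fun q => (q.2, q.1))); split.
  - apply: plane_isometry_comp swap_isometry; apply: affine_fst_isometry.
    by rewrite /k; case: ifP => _; rewrite ?sqrrN expr1n.
  - rewrite /= mul0r addr0 /k; case: ifPn => [|p2]; first by rewrite mul1r.
    by rewrite mulN1r oppr_ge0 ltW// ltNge.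
  - exact: p10.
pose r := Num.sqrt (p.1 ^+ 2 + p.2 ^+ 2).
have r20 : 0 < p.1 ^+ 2 + p.2 ^+ 2.
  by rewrite ltr_pwDl ?sqr_ge0// lt0r sqr_ge0 sqrf_eq0 p10.
have r0 : r != 0 by rewrite gt_eqF// sqrtr_gt0.
have rr : r ^+ 2 = p.1 ^+ 2 + p.2 ^+ 2 by rewrite sqr_sqrtr// ltW.
pose c := p.1 / r; pose s := p.2 / r.
have c0 : c != 0 by rewrite mulf_neq0// invr_eq0.
have cs : c ^+ 2 + s ^+ 2 = 1 by rewrite /c /s; field: rr; rewrite r0.
pose g := affine_snd c^-1 (- s / c) \o affine_fst c s.
have gE q : g q = (c * q.1 + s * q.2, - s * q.1 + c * q.2).
  rewrite /g/=; congr pair; apply: (mulfI c0).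
  rewrite -[RHS]subr0 -[X in _ - X](mul0r q.2) -(subrr 1) -{1}cs /affine_snd/=.
  by field.
exists g; split; last 2 first.
- rewrite gE/= /c /s; have -> : p.1 / r * p.1 + p.2 / r * p.2 = r.
    by field: rr; rewrite r0.
  exact: sqrtr_ge0.
- by rewrite gE/= /c /s; field.
split.
- by apply: measurableT_comp; [exact: measurable_affine_snd|exact:
    measurable_affine_fst].
- move=> A mA; rewrite [RHS](@area_affine_snd c^-1 (- s / c))// ?invr_eq0//.
  rewrite [X in (_ * X)%E](@area_affine_fst c s)//; last first.
    by rewrite -[_ @^-1` _]setTI; exact: measurable_affine_snd.
  by rewrite muleA -EFinM -normrM mulVf// normr1 mul1e.
- move=> a b; rewrite !gE /dot2/=.
  rewrite -[RHS]mul1r -cs; ring.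
Qed.

End plane_maps.

(** * Isometries of space *)

Section space_maps.
Context {R : realType}.
Local Notation T := (measurableTypeR R).
Local Notation T3 := (T * T * T)%type.

Definition dot3 (p q : T3) : R :=
  p.1.1 * q.1.1 + p.1.2 * q.1.2 + p.2 * q.2.

Definition space_isometry (f : T3 -> T3) :=
  [/\ measurable_fun setT f,
      forall A, measurable A -> volume (f @^-1` A) = volume A &
      forall p q, dot3 (f p) (f q) = dot3 p q].

Lemma space_isometry_comp (f g : T3 -> T3) :
  space_isometry f -> space_isometry g -> space_isometry (f \o g).
Proof.
move=> [mf vf df] [mg vg dg]; split; first exact: measurableT_comp.
- move=> A mA; rewrite comp_preimage vg ?vf//.
  by rewrite -[_ @^-1` _]setTI; exact: mf.
- by move=> p q /=; rewrite df dg.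
Qed.

Definition on_fst2 (g : T * T -> T * T) (p : T3) : T3 := (g p.1, p.2).

Definition on_snd2 (g : T * T -> T * T) (p : T3) : T3 :=
  let q := g (p.1.2, p.2) in (p.1.1, q.1, q.2).

Lemma on_fst2_isometry g : plane_isometry g -> space_isometry (on_fst2 g).
Proof.
move=> [mg vg dg].
have mf : measurable_fun setT (on_fst2 g).
  apply/measurable_fun_pairP; split; last exact: measurable_snd.
  exact: (measurableT_comp mg measurable_fst).
split; first exact: mf.
- move=> A mA; have mfA : measurable (on_fst2 g @^-1` A).
    by rewrite -[_ @^-1` _]setTI; exact: mf.
  rewrite (volume_zsection mA) (volume_zsection mfA); apply: eq_integral => z _.
  by rewrite -(vg _ (measurable_ysection z mA)).
- by move=> p q; rewrite /dot3/= -!/(dot2 _ _) dg.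
Qed.

Lemma on_snd2_isometry g : plane_isometry g -> space_isometry (on_snd2 g).
Proof.
move=> [mg vg dg].
have mf : measurable_fun setT (on_snd2 g).
  have mg2 : measurable_fun setT (fun p : T3 => g (p.1.2, p.2)).
    apply: (measurableT_comp mg); apply/measurable_fun_pairP; split.
      exact: (measurableT_comp measurable_snd measurable_fst).
    exact: measurable_snd.
  apply/measurable_fun_pairP; split;
    last exact: (measurableT_comp measurable_snd mg2).
  apply/measurable_fun_pairP; split.
    exact: (measurableT_comp measurable_fst measurable_fst).
  exact: (measurableT_comp measurable_fst mg2).
split; first exact: mf.
- move=> A mA; have mfA : measurable (on_snd2 g @^-1` A).
    by rewrite -[_ @^-1` _]setTI; exact: mf.
  rewrite (volume_xsection mA) (volume_xsection mfA); apply: eq_integral => x _.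
  rewrite -[RHS]vg; last first.
    pose h (q : T * T) : T3 := ((x, q.1), q.2).
    have mh : measurable_fun setT h.
      apply/measurable_fun_pairP; split; last exact: measurable_snd.
      apply/measurable_fun_pairP; split; last exact: measurable_fst.
      exact: measurable_cst.
    by rewrite -[X in measurable X]/(h @^-1` A) -[_ @^-1` _]setTI; exact: mh.
  by congr area; apply/seteqP; split=> q;
    rewrite /on_snd2/= -surjective_pairing.
- move=> p q; rewrite /dot3/=.
  have := dg (p.1.2, p.2) (q.1.2, q.2); rewrite /dot2/= => e.
  by rewrite -!addrA e.
Qed.

(** Three plane isometries, each acting on two coordinates: two carry [a] to the first axis, the
    last one carries [b] into the plane of the first two coordinates. *)
Lemma space_frame (a b : T3) : exists f,
  [/\ space_isometry f, 0 <= (f a).1.1, (f a).1.2 = 0, (f a).2 = 0 &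
      0 <= (f b).1.2 /\ (f b).2 = 0].
Proof.
have [g1 [hg1 _ g1a]] := plane_rotation (a.1.2, a.2).
pose a1 := on_snd2 g1 a.
have [g2 [hg2 g2a0 g2a]] := plane_rotation a1.1.
pose b1 := on_fst2 g2 (on_snd2 g1 b).
have [g3 [hg3 g3b0 g3b]] := plane_rotation (b1.1.2, b1.2).
(* Hence the last map leaves [a] on the first axis. *)
have g30 : g3 (0, 0) = (0, 0).
  have [_ _ d3] := hg3; have := d3 (0, 0) (0, 0); rewrite /dot2/= !mulr0 addr0.
  move=> /eqP; rewrite paddr_eq0 ?sqr_ge0// -!expr2 !sqrf_eq0.
  by move=> /andP[/eqP e1 /eqP e2]; rewrite [LHS]surjective_pairing e1 e2.
exists (on_snd2 g3 \o (on_fst2 g2 \o on_snd2 g1)); split.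
- apply: space_isometry_comp (on_snd2_isometry hg3) _.
  exact: space_isometry_comp (on_fst2_isometry hg2) (on_snd2_isometry hg1).
- exact: g2a0.
- by rewrite /on_snd2 /= g2a g1a g30.
- by rewrite /on_snd2 /= g2a g1a g30.
- by split; [exact: g3b0|exact: g3b].
Qed.

Lemma opp_isometry : space_isometry (fun p => (- p.1.1, - p.1.2, - p.2)).
Proof.
have hr : plane_isometry (affine_fst (-1 : R) 0).
  by apply: affine_fst_isometry; rewrite sqrrN expr1n.
have hs := @swap_isometry R.
(* One sign change per coordinate; the third is reached by conjugating with the swap. *)
pose f := on_fst2 (affine_fst (-1) 0) \o on_snd2 (affine_fst (-1) 0)
  \o on_snd2 ((fun q => (q.2, q.1)) \o affine_fst (-1) 0
  \o (fun q => (q.2, q.1))).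
suff -> : (fun p : T3 => (- p.1.1, - p.1.2, - p.2)) = f.
  do !apply: space_isometry_comp.
  - exact: on_fst2_isometry.
  - exact: on_snd2_isometry.
  - by apply: on_snd2_isometry; do !apply: plane_isometry_comp.
by apply/funext => -[[x y] z]; rewrite /f/= /on_fst2 /on_snd2 /affine_fst/=
  !mul0r !addr0 !mulN1r.
Qed.

End space_maps.

(** * Wedges and corners of the unit ball *)

Lemma measurable_le_set {d} {T : measurableType d} {R : realType} (f g : T ->
  R) :
  measurable_fun setT f -> measurable_fun setT g ->
  measurable [set x | f x <= g x].
Proof.
move=> mf mg; have := measurable_fun_ler mf mg => /(_ measurableT [set true]).
by rewrite setTI; apply.
Qed.

Lemma measurable_lt_set {d} {T : measurableType d} {R : realType} (f g : T ->
  R) :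
  measurable_fun setT f -> measurable_fun setT g ->
  measurable [set x | f x < g x].
Proof.
move=> mf mg; have := measurable_fun_ltr mf mg => /(_ measurableT [set true]).
by rewrite setTI; apply.
Qed.

Lemma integral_itv_derivative {R : realType} (f F : R -> R) (a b : R) :
  a < b -> continuous f -> (forall x : R, is_derive x 1 F (f x)) ->
  (\int[leb]_(x in `[a, b]) (f x)%:E = (F b - F a)%:E)%E.
Proof.
move=> ab cf dF; have cF : continuous F.
  by move=> x; apply/differentiable_continuous/derivable1_diffP;
    have [] := dF x.
rewrite EFinB; apply: continuous_FTC2 => //.
- exact: continuous_subspaceT.
- split; first by move=> x _; have [] := dF x.
    by apply: cvg_at_right_filter; exact: cF.
  by apply: cvg_at_left_filter; exact: cF.
- by move=> x _; rewrite derive1E; exact: derive_val.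
Qed.

Section sector.
Context {R : realType} (k c : R).
Context (c0 : 0 < c).
Local Notation T := (measurableTypeR R).

Definition sector : set (T * T) :=
  [set q | [/\ 0 < q.1, k * q.1 <= q.2 & q.1 ^+ 2 + q.2 ^+ 2 <= c]].

(* The sector in the coordinates (x, slope): [y = x * s]. *)
Let slopes : set (T * T) :=
  [set q | [/\ 0 < q.1, k <= q.2 & q.1 ^+ 2 * (1 + q.2 ^+ 2) <= c]].

Let measurable_slopes : measurable slopes.
Proof.
have -> : slopes = [set q | 0 < q.1] `&` [set q | k <= q.2]
    `&` [set q | q.1 ^+ 2 * (1 + q.2 ^+ 2) <= c].
  by apply/seteqP; split=> [q []|q [[]]].
apply: measurableI; first apply: measurableI.
- by apply: measurable_lt_set => //; exact: measurable_fst.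
- by apply: measurable_le_set => //; exact: measurable_snd.
- apply: measurable_le_set => //; apply: measurable_funM.
    by apply: measurable_funX; exact: measurable_fst.
  by apply: measurable_funD => //; apply: measurable_funX;
    exact: measurable_snd.
Qed.

(** The density is the Jacobian of [y = x * s], truncated at 0 so that the integrand is nonnegative
    everywhere, as Tonelli requires. *)
Let phi (q : T * T) : \bar R := (Num.max q.1 0 * \1_slopes q)%:E.

Let measurable_phi : measurable_fun setT phi.
Proof.
apply/measurable_EFinP; apply: measurable_funM.
  by apply: measurable_maxr => //; exact: measurable_fst.
exact: measurable_indic.
Qed.

Let phi_ge0 q : (0 <= phi q)%E.
Proof. by rewrite lee_fin mulr_ge0// le_max lexx orbT. Qed.

Lemma measurable_sector : measurable sector.
Proof.
have -> : sector = [set q | 0 < q.1] `&` [set q | k * q.1 <= q.2]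
    `&` [set q | q.1 ^+ 2 + q.2 ^+ 2 <= c].
  by apply/seteqP; split=> [q []|q [[]]].
apply: measurableI; first apply: measurableI.
- by apply: measurable_lt_set => //; exact: measurable_fst.
- apply: measurable_le_set; last exact: measurable_snd.
  by apply: measurable_funM => //; exact: measurable_fst.
- apply: measurable_le_set => //; apply: measurable_funD.
    exact: (measurable_funX 2 measurable_fst).
  exact: (measurable_funX 2 measurable_snd).
Qed.

Let sector_phi : area sector = (\int[leb]_x \int[leb]_s phi (x, s))%E.
Proof.
rewrite area_xsection; apply: eq_integral => x _.
have [x0|x0] := leP x 0.
  have -> : xsection sector x = set0.
    apply/seteqP; split=> // y; rewrite /xsection/= inE => -[/=].
    by rewrite ltNge x0.
  rewrite measure0 integral0_eq// => s _; rewrite /phi/= max_r//.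
  by rewrite mul0r.
rewrite (@lebesgue_measure_affine R x 0) ?gt_eqF//; last first.
  exact: measurable_xsection measurable_sector.
rewrite gtr0_norm//.
transitivity (\int[leb]_s (x%:E * (\1_(xsection slopes x) s)%:E))%E; last first.
  apply: eq_integral => s _; rewrite /phi/= max_l ?ltW// -EFinM.
  by rewrite !indicE mem_xsection.
rewrite ge0_integralZl//; last first.
- by rewrite lee_fin ltW.
- apply/measurable_EFinP; apply: measurable_indic.
  exact: measurable_xsection.
rewrite integral_indic//; last exact: measurable_xsection.
rewrite setIT; congr (_ * lebesgue_measure _)%E.
apply/seteqP; split=> s; rewrite /xsection/= !inE /affine_fun => -[/= _ h1 h2];
  split=> //=.
- by move: h1; rewrite addr0 mulrC ler_pM2l.
- by move: h2; rewrite addr0; apply: le_trans; rewrite exprMn mulrDr mulr1.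
- by rewrite addr0 mulrC ler_pM2l.
- by rewrite addr0; apply: le_trans h2; rewrite exprMn mulrDr mulr1.
Qed.

Let inner_integral s :
  (\int[leb]_x phi (x, s) =
   (if (k <= s)%R then (c / 2 * (1 + s ^+ 2)^-1)%:E else 0))%E.
Proof.
have [ks|ks] := leP k s; last first.
  rewrite integral0_eq// => x _; rewrite /phi indicE memNset ?mulr0//=.
  by case=> _ /=; rewrite leNgt ks.
have s0 : 0 < 1 + s ^+ 2 by rewrite ltr_pwDl// sqr_ge0.
pose b := Num.sqrt (c / (1 + s ^+ 2)).
have b0 : 0 < b by rewrite sqrtr_gt0 divr_gt0.
have b2 : b ^+ 2 = c / (1 + s ^+ 2) by rewrite sqr_sqrtr// ltW// divr_gt0.
transitivity (\int[leb]_(x in `[0%R, b]) x%:E)%E.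
  rewrite [RHS]integral_mkcond; apply: eq_integral => x _.
  rewrite patchE /phi/= indicE; case: ifPn => xb; last first.
    rewrite memNset ?mulr0// => -[/= x0 _ xc].
    move/negP: xb; apply; rewrite inE/= in_itv/= (ltW x0)/=.
    by rewrite -(@ler_pXn2r _ 2)// ?nnegrE ?(ltW x0) ?(ltW b0)// b2 ler_pdivlMr.
  move: xb; rewrite inE/= in_itv/= => /andP[x0 xb].
  move: x0; rewrite le_eqVlt => /predU1P[<-|x0]; first by rewrite maxxx mul0r.
  rewrite max_l ?(ltW x0)// mem_set ?mulr1//; split=> //=.
  by rewrite -ler_pdivlMr// -b2 ler_pXn2r// nnegrE ltW.
have dsq (x : R) : is_derive x 1 (fun x => x ^+ 2 / 2 : R) x.
  have := is_deriveM (is_deriveM (is_derive_id x 1) (is_derive_id x 1))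
    (is_derive_cst (2^-1 : R) x 1).
  by move=> /is_derive_eq; apply; rewrite /GRing.scale/=; field.
rewrite (@integral_itv_derivative R id _ 0 b b0 _ dsq); last by move=> x;
  exact: cvg_id.
by rewrite b2 expr0n/= mul0r subr0; congr EFin; field; rewrite gt_eqF.
Qed.

(** Integrating over [x] first leaves a multiple of [(1 + s ^+ 2)^-1] to integrate from [k] to
    infinity, so the arctangent appears without polar coordinates. *)
Lemma area_sector : area sector = (c / 2 * (pi / 2 - atan k))%:E.
Proof.
rewrite sector_phi.
rewrite (fubini_tonelli phi measurable_phi phi_ge0).
transitivity (\int[leb]_(s in `[k, +oo[) (c / 2 * (1 + s ^+ 2)^-1)%:E)%E.
  rewrite [RHS]integral_mkcond; apply: eq_integral => s _.
  rewrite inner_integral patchE.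
  by rewrite mem_setE/= in_itv/= andbT.
have dF (x : R) :
    is_derive x 1 (fun s => c / 2 * atan s : R) (c / 2 * (1 + x ^+ 2)^-1).
  have := is_deriveM (is_derive_cst (c / 2 : R) x 1) (is_derive1_atan x).
  by move=> /is_derive_eq; apply; rewrite /GRing.scale/= mulr0 addr0.
rewrite (@ge0_continuous_FTC2y R _ (fun s => c / 2 * atan s) k (c / 2 * (pi /
  2))).
- by rewrite -EFinB -mulrBr.
- move=> x _; rewrite mulr_ge0 ?divr_ge0 ?(ltW c0)// invr_ge0.
  by rewrite addr_ge0// sqr_ge0.
- apply: continuous_subspaceT => x; apply: cvgM; first exact: cvg_cst.
  exact: continuous_oneDsqrV.
- by apply: cvgM; [exact: cvg_cst|exact: cvgy_atan].
- by move=> x _; have [] := dF x.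
- apply: cvg_at_right_filter; apply: cvgM; first exact: cvg_cst.
  exact: continuous_atan.
- by move=> x _; rewrite derive1E; exact: derive_val.
Qed.

End sector.

Section wedge.
Context {R : realType}.
Local Notation T := (measurableTypeR R).
Local Notation T3 := (T * T * T)%type.

Definition unit_ball3 : set T3 := [set p | dot3 p p <= 1].

Lemma measurable_coordinates : [/\ measurable_fun setT (fun p : T3 => p.1.1 :
  R),
  measurable_fun setT (fun p : T3 => p.1.2 : R) &
  measurable_fun setT (fun p : T3 => p.2 : R)].
Proof.
split; last exact: measurable_snd.
  exact: (measurableT_comp measurable_fst measurable_fst).
exact: (measurableT_comp measurable_snd measurable_fst).
Qed.

Lemma measurable_dot3 (a : T3) : measurable_fun setT (dot3 a).
Proof.
have [mx my mz] := measurable_coordinates.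
by apply: measurable_funD; [apply: measurable_funD|]; apply: measurable_funM.
Qed.

Lemma measurable_unit_ball3 : measurable unit_ball3.
Proof.
apply: measurable_le_set => //.
have [mx my mz] := measurable_coordinates.
by apply: measurable_funD; [apply: measurable_funD|]; apply: measurable_funM.
Qed.

Definition halfspace (a : T3) : set T3 := [set p | 0 <= dot3 a p].

Lemma measurable_halfspace a : measurable (halfspace a).
Proof. by apply: measurable_le_set => //; exact: measurable_dot3. Qed.

Definition axis_wedge (k : R) : set T3 :=
  [set p | 0 < p.1.1 /\ k * p.1.1 <= p.1.2].

Lemma measurable_axis_wedge k : measurable (axis_wedge k).
Proof.
have [mx my _] := measurable_coordinates.
rewrite (_ : axis_wedge k = [set p | 0 < p.1.1] `&` [set p | k * p.1.1 <=
  p.1.2])//.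
apply: measurableI; first exact: measurable_lt_set.
by apply: measurable_le_set => //; exact: measurable_funM.
Qed.

(** The slice at height [z] is a sector with [c = 1 - z ^+ 2], and this function has integral 4/3
    over [-1, 1]. *)
Lemma volume_axis_wedge (k : R) :
  volume (axis_wedge k `&` unit_ball3) =
  (2 / 3 * (pi / 2 - atan k))%:E.
Proof.
set A := (X in volume X).
have mA : measurable A.
  apply: measurableI; last exact: measurable_unit_ball3.
  exact: measurable_axis_wedge.
rewrite (volume_zsection mA).
pose beta := pi / 2 - atan k.
have dF (z : R) : is_derive z 1 (fun z => beta / 2 * (z - z * z * z / 3) : R)
    (beta / 2 * (1 - z ^+ 2)).
  have dz := is_derive_id z (1 : R).
  have dz3 := is_deriveM (is_deriveM (is_deriveM dz dz) dz) (is_derive_cst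
    (3^-1 : R) z 1).
  have := is_deriveM (is_derive_cst (beta / 2 : R) z 1) (is_deriveB dz dz3).
  by move=> /is_derive_eq; apply; rewrite /GRing.scale/= !fctE; field.
transitivity (\int[leb]_(z in `[(-1)%R, 1%R]) (beta / 2 * (1 - z ^+ 2))%:E)%E;
  last first.
  rewrite (@integral_itv_derivative R _ _ (-1) 1 _ _ dF).
  - by congr EFin; rewrite /beta; field.
  - by lra.
  - move=> z; apply: cvgM; first exact: cvg_cst.
    by apply: cvgB; [exact: cvg_cst|exact: exprn_continuous].
rewrite [RHS]integral_mkcond; apply: eq_integral => z _;
  rewrite patchE mem_setE/= in_itv/=.
case: ifPn => [/andP[z1 z2]|z1].
  (* [area_sector] needs [c] positive; at the two poles the slice is empty. *)
  have [zz|zz] := eqVneq (1 - z ^+ 2) 0.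
    rewrite zz mulr0 [X in area X](_ : _ = set0) ?measure0//.
    apply/seteqP; split=> // -[x y]; rewrite /ysection/= inE => -[[/= x0 _] h3].
    have {}h3 : x ^+ 2 + y ^+ 2 + z ^+ 2 <= 1 by rewrite !expr2; exact: h3.
    by have := exprn_gt0 2 x0; have := sqr_ge0 y; lra.
  have z0 : 0 < 1 - z ^+ 2 by rewrite lt0r zz; nra.
  have := area_sector k z0; rewrite -/beta => e.
  transitivity ((1 - z ^+ 2) / 2 * beta)%:E; last by congr EFin; field.
  rewrite -e; congr area; apply/seteqP; split=> -[x y]; rewrite /ysection/= inE.
    move=> [[/= h1 h2] h3]; split=> //=; rewrite lerBrDr.
    by rewrite !expr2; exact: h3.
  by move=> [/= h1 h2 h3]; split=> //; move: h3; rewrite lerBrDr !expr2.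
rewrite [X in area X](_ : _ = set0) ?measure0//.
apply/seteqP; split=> // -[x y]; rewrite /ysection/= inE => -[_ h3].
have {}h3 : x ^+ 2 + y ^+ 2 + z ^+ 2 <= 1 by rewrite !expr2; exact: h3.
have z2 : z ^+ 2 <= 1 by have := sqr_ge0 x; have := sqr_ge0 y; lra.
by apply: (negP z1); apply/andP; split; nra.
Qed.

End wedge.

Section solid_angle.
Context {R : realType}.
Local Notation T := (measurableTypeR R).
Local Notation T3 := (T * T * T)%type.
Lemma volume_eq_mod_null (A B N : set T3) :
  measurable A -> measurable B -> measurable N -> volume N = 0%E ->
  A `<=` B `|` N -> B `<=` A `|` N -> volume A = volume B.
Proof.
have half (X Y : set T3) : measurable X -> measurable Y -> measurable N ->
    volume N = 0%E -> X `<=` Y `|` N -> (volume X <= volume Y)%E.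
  move=> mX mY mN N0 XY.
  have mYN : measurable (Y `|` N) := measurableU _ _ mY mN.
  apply: (le_trans (le_measure volume (mem_set mX) (mem_set mYN) XY)).
  by rewrite -[leRHS]adde0 -N0; exact: measureU2.
by move=> mA mB mN N0 AB BA; apply/eqP; rewrite eq_le !half.
Qed.

Lemma measurable_plane (a : T3) : measurable [set p | dot3 a p = 0].
Proof.
have -> : [set p | dot3 a p = 0] = dot3 a @^-1` [set 0] by [].
by rewrite -[_ @^-1` _]setTI; exact: (measurable_dot3 a).
Qed.

(** After an isometry the normal lies on the first axis, and every line parallel to that axis meets
    the plane in one point. *)
Lemma volume_plane (a : T3) :
  dot3 a a != 0 -> volume [set p | dot3 a p = 0] = 0%E.
Proof.
move=> a0; have [f [[mf vf df] _ fa2 fa3 _]] := space_frame a a.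
have fa1 : (f a).1.1 != 0.
  apply: contraNneq a0 => fa1; rewrite -df /dot3 fa1 fa2 fa3.
  by rewrite !mulr0 !addr0.
have -> : [set p | dot3 a p = 0] = f @^-1` [set q | dot3 (f a) q = 0].
  by apply/seteqP; split=> p /=; rewrite df.
rewrite (vf _ (measurable_plane _)) (volume_zsection (measurable_plane _)).
apply: integral0_eq => z _.
rewrite (area_ysection (measurable_ysection z (measurable_plane _))).
apply: integral0_eq => y _.
rewrite [X in leb X](_ : _ = [set 0]); last first.
  have e0 (x : R) : dot3 (f a) (x, y, z) = (f a).1.1 * x.
    by rewrite /dot3 fa2 fa3 !mul0r !addr0.
  apply/seteqP; split=> x; rewrite /ysection/= !inE/= inE/= e0.
    by move/eqP; rewrite mulf_eq0 (negbTE fa1)/= => /eqP.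
  by move=> ->; rewrite mulr0.
exact: lebesgue_measure_set1.
Qed.

(** In the frame of [space_frame], and up to the null plane orthogonal to [a], the two half-spaces
    intersect in the [axis_wedge] of slope [- (b1 / b2)]. *)
Lemma volume_wedge (a b : T3) :
  0 < dot3 a a * dot3 b b - dot3 a b ^+ 2 ->
  volume (halfspace a `&` halfspace b `&` unit_ball3) =
  (2 / 3 * (pi / 2 + atan (dot3 a b /
    Num.sqrt (dot3 a a * dot3 b b - dot3 a b ^+ 2))))%:E.
Proof.
move=> D0; have [f [[mf vf df] fa1 fa2 fa3 [fb2 fb3]]] := space_frame a b.
have mW (x y : T3) : measurable (halfspace x `&` halfspace y `&` unit_ball3).
  apply: measurableI; last exact: measurable_unit_ball3.
  by apply: measurableI; exact: measurable_halfspace.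
have -> : halfspace a `&` halfspace b `&` unit_ball3 =
    f @^-1` (halfspace (f a) `&` halfspace (f b) `&` unit_ball3).
  by apply/seteqP; split=> p; rewrite /halfspace /unit_ball3/= !df.
rewrite (vf _ (mW _ _)) -(df a a) -(df b b) -(df a b).
rewrite -(df a a) -(df b b) -(df a b) in D0.
move: (f a) (f b) fa1 fa2 fa3 fb2 fb3 D0 => {a b df} [[a1 a2] a3] [[b1 b2]
  b3]/=.
move=> a10 -> -> b20 -> {a2 a3 b3}.
set a : T3 := (a1, 0, 0); set b : T3 := (b1, b2, 0) => D0.
have DE : dot3 a a * dot3 b b - dot3 a b ^+ 2 = (a1 * b2) ^+ 2.
  by rewrite /dot3/=; ring.
have a1b2 : a1 * b2 != 0 by move: D0; rewrite DE; apply: contraTneq => ->;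
  rewrite expr0n ltxx.
have /norP[a1n0 b2n0] : ~~ ((a1 == 0) || (b2 == 0)) by rewrite -mulf_eq0.
have a1_gt0 : 0 < a1 by rewrite lt0r a1n0.
have b2_gt0 : 0 < b2 by rewrite lt0r b2n0.
rewrite DE sqrtr_sqr ger0_norm ?mulr_ge0//.
have -> : dot3 a b / (a1 * b2) = - - (b1 / b2).
  by rewrite opprK /dot3/=; field; rewrite a1n0 b2n0.
rewrite (atanN (- (b1 / b2))) -volume_axis_wedge.
apply: (@volume_eq_mod_null _ _ [set p | dot3 a p = 0]).
- exact: mW.
- apply: measurableI; last exact: measurable_unit_ball3.
  exact: measurable_axis_wedge.
- exact: measurable_plane.
- by apply: volume_plane; rewrite /dot3/= !mulr0 !addr0 mulf_neq0.
- move=> -[[x y] z] [[ha hb] hB].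
  have {}ha : 0 <= a1 * x by move: ha;
    rewrite /halfspace/= /dot3/= !mul0r !addr0.
  have {}hb : 0 <= b1 * x + b2 * y by move: hb;
    rewrite /halfspace/= /dot3/= !mul0r !addr0.
  have x0 : 0 <= x by rewrite -(pmulr_rge0 _ a1_gt0).
  have [->|xn0] := eqVneq x 0.
    by right; rewrite /= /dot3/= !mul0r !mulr0 !addr0.
  left; split; last exact: hB.
  split=> /=; first by rewrite lt0r xn0.
  by rewrite -(ler_pM2l b2_gt0) -subr_ge0;
    have -> : b2 * y - b2 * (- (b1 / b2) * x) = b1 * x + b2 * y by field.
- move=> -[[x y] z] [[/= ha hb] hB]; left; split; last exact: hB.
  split; rewrite /halfspace/= /dot3/= !mul0r !addr0.
    by rewrite mulr_ge0// ltW.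
  by have -> : b1 * x + b2 * y = b2 * (y - (- (b1 / b2) * x));
    [field|rewrite mulr_ge0// subr_ge0].
Qed.

Definition opp3 (p : T3) : T3 := (- p.1.1, - p.1.2, - p.2).

(** The halves overlap only in a null plane, so the opposite half-space may be replaced by its
    interior, which is disjoint from the first. *)
Lemma volume_halfspaces_split (n : T3) (A : set T3) : measurable A ->
  dot3 n n != 0 ->
  volume A = (volume (A `&` halfspace n) + volume (A `&` halfspace (opp3 n)))%E.
Proof.
move=> mA n0; have mn := measurable_halfspace n.
pose N := [set p | 0 < dot3 (opp3 n) p].
have mN : measurable N by apply: measurable_lt_set => //;
  exact: measurable_dot3.
have oppE p : dot3 (opp3 n) p = - dot3 n p by rewrite /dot3/=; ring.
rewrite (@volume_eq_mod_null (A `&` halfspace (opp3 n)) (A `&` N) [set p | dot3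
  n p = 0]).
- rewrite -measureU.
  + congr volume; rewrite -setIUr; apply/seteqP; split=> [p Ap|p []//].
    split=> //; rewrite /N /halfspace/= oppE oppr_gt0.
    by case: (leP 0 (dot3 n p)); [left|right].
  + exact: measurableI.
  + exact: measurableI.
  + apply/seteqP; split=> // p [[_ hp] [_ hn]].
    by move: hp hn; rewrite /N /halfspace/= oppE oppr_gt0 leNgt => /negP.
- by apply: measurableI => //; exact: measurable_halfspace.
- exact: measurableI.
- exact: measurable_plane.
- exact: volume_plane.
- move=> p [Ap]; rewrite /halfspace/= le_eqVlt => /predU1P[e|?]; last by left.
  by right; apply/eqP; rewrite /= -oppr_eq0 -oppE -e.
- by move=> p [Ap hp]; left; split=> //; exact: ltW.
Qed.

(** The angle of the wedge with inner normals [a] and [b]: [pi] minus the angle between the normals,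
    whose cotangent is the argument of [atan]. *)
Definition dihedral (a b : T3) : R :=
  pi / 2 + atan (dot3 a b / Num.sqrt (dot3 a a * dot3 b b - dot3 a b ^+ 2)).

Let EFin_split (r : R) (x y : \bar R) : (0 <= x)%E -> (0 <= y)%E ->
  (r%:E = x + y)%E -> exists x' y', [/\ x = x'%:E, y = y'%:E & r = x' + y'].
Proof.
case: x => [x||]//; case: y => [y||]// _ _.
by rewrite -EFinD => -[->]; exists x, y.
Qed.

(* With [v(+++)], ... the volumes of the eight pieces cut out of the ball,
   [W(b,c) = v(+++) + v(-++)], [W(a,c) = v(+++) + v(+-+)] and
   [W(a,-b) = v(+-+) + v(+--)], where [v(+--) = v(-++)] by the antipodal map;
   hence [2 v(+++) = W(b,c) + W(a,c) - W(a,-b)]. *)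
Lemma volume_corner (a b c : T3) :
  0 < dot3 a a * dot3 b b - dot3 a b ^+ 2 ->
  0 < dot3 b b * dot3 c c - dot3 b c ^+ 2 ->
  0 < dot3 a a * dot3 c c - dot3 a c ^+ 2 ->
  volume (halfspace a `&` halfspace b `&` halfspace c `&` unit_ball3) =
  ((dihedral a b + dihedral b c + dihedral a c - pi) / 3)%:E.
Proof.
move=> Dab Dbc Dac.
have mW (x y : T3) : measurable (halfspace x `&` halfspace y `&` unit_ball3).
  apply: measurableI; last exact: measurable_unit_ball3.
  by apply: measurableI; exact: measurable_halfspace.
have nz (x y : T3) : 0 < dot3 x x * dot3 y y - dot3 x y ^+ 2 ->
    dot3 x x != 0 /\ dot3 y y != 0.
  move=> D; split; apply: contraTneq D => ->.
    by rewrite mul0r sub0r oppr_gt0 -leNgt sqr_ge0.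
  by rewrite mulr0 sub0r oppr_gt0 -leNgt sqr_ge0.
have [a0 b0] := nz _ _ Dab; have [_ c0] := nz _ _ Dbc.
pose b' := opp3 b.
have abE : dot3 a b' = - dot3 a b by rewrite /b' /dot3/=; ring.
have bbE : dot3 b' b' = dot3 b b by rewrite /b' /dot3/=; ring.
have Dab' : 0 < dot3 a a * dot3 b' b' - dot3 a b' ^+ 2 by rewrite abE bbE sqrrN.
have h1 := volume_halfspaces_split (mW b c) a0.
have h2 := volume_halfspaces_split (mW a c) b0.
have h3 := volume_halfspaces_split (mW a b') c0.
rewrite volume_wedge// in h1; rewrite volume_wedge// in h2.
(* Since [atan] is odd, the wedge of [a] and [b'] has angle [pi - dihedral a b]. *)
rewrite volume_wedge// abE bbE sqrrN mulNr atanN in h3.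
have perm (X Y Z : set T3) : X `&` Y `&` unit_ball3 `&` Z = X `&` Y `&` Z `&`
  unit_ball3.
  by rewrite setIAC.
rewrite !perm in h1 h2 h3.
have [v1 [p [v1E pE e1]]] :=
  EFin_split (measure_ge0 volume _) (measure_ge0 volume _) h1.
have [v2 [q [v2E qE e2]]] :=
  EFin_split (measure_ge0 volume _) (measure_ge0 volume _) h2.
have [q' [p' [q'E p'E e3]]] :=
  EFin_split (measure_ge0 volume _) (measure_ge0 volume _) h3.
have v1_E : volume (halfspace a `&` halfspace b `&` halfspace c `&` unit_ball3)
  = v1%:E.
  by rewrite -v1E; congr volume; congr (_ `&` _); rewrite -setIA setIC.
have v12 : v1 = v2.
  apply: EFin_inj; rewrite -v1_E -v2E; congr volume; congr (_ `&` _).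
  by rewrite setIAC.
have qq : q = q'.
  apply: EFin_inj; rewrite -qE -q'E; congr volume; congr (_ `&` _).
  by rewrite setIAC.
have pp : p = p'.
  apply: EFin_inj; rewrite -pE -p'E.
  have [_ vo _] := @opp_isometry R.
  apply/esym; apply: (etrans (esym (vo _ _))).
    rewrite -perm; apply: measurableI; last exact: measurable_halfspace.
    exact: mW.
  have dotNr (x y : T3) : dot3 x (opp3 y) = dot3 (opp3 x) y.
    by rewrite /dot3/=; ring.
  have oppK (x : T3) : opp3 (opp3 x) = x.
    by case: x => [[x y] z]; rewrite /opp3/= !opprK.
  congr volume; apply/seteqP.
  rewrite /preimage /halfspace /unit_ball3/=.
  split=> x /=; rewrite !dotNr -/(opp3 x) !oppK.
    by move=> [[[? ?] ?] ?].
  by move=> [[[? ?] ?] ?].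
by rewrite v1_E; congr EFin; rewrite /dihedral; lra.
Qed.

End solid_angle.

(** * The solid angles of a sphere packing *)

(** The sum lies strictly between 0 and [pi]; shifting it by [pi / 2] brings it into the range of
    [atan] and includes the right angle [x * y = 1]. *)
Lemma atan_add (R : realType) (x y : R) : 0 < x + y ->
  atan x + atan y = pi / 2 + atan ((x * y - 1) / (x + y)).
Proof.
move=> xy0; set a := atan x; set b := atan y.
have ca : 0 < cos a by rewrite cos_gt0_pihalf// atan_gtNpi2 atan_ltpi2.
have cb : 0 < cos b by rewrite cos_gt0_pihalf// atan_gtNpi2 atan_ltpi2.
have tE (z : R) : 0 < cos (atan z) -> sin (atan z) = z * cos (atan z).
  move=> cz; have : sin (atan z) / cos (atan z) = z := atanK z.
  by move=> /(congr1 ( *%R^~ (cos (atan z)))); rewrite divfK// gt_eqF.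
have sa : sin a = x * cos a by exact: tE.
have sb : sin b = y * cos b by exact: tE.
have ab0 : - b < a by rewrite /a /b -atanN lt_atan// ltrNl -subr_gt0 opprK
  addrC.
have a1 := atan_ltpi2 x; have b1 := atan_ltpi2 y.
have tt : tan (a + b - pi / 2) = (x * y - 1) / (x + y).
  rewrite /tan sinB cosB cos_pihalf sin_pihalf !mulr0 !mulr1 sub0r add0r.
  rewrite sinD cosD sa sb; field.
  rewrite !gt_eqF//=.
  have -> : x * cos a * cos b + cos a * (y * cos b) = (x + y) * (cos a * cos b)
    by ring.
  by rewrite !mulr_gt0.
rewrite -tt tanK; first by rewrite addrC -/a -/b; ring.
rewrite in_itv/= -/a -/b; apply/andP; split; rewrite -/a -/b in a1 b1; lra.
Qed.

(** * Cones, Gram matrices and dihedral angles *)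

Section vectors.
Context {R : realType}.
Local Notation T := (measurableTypeR R).
Local Notation T3 := (T * T * T)%type.
Definition cross3 (u v : T3) : T3 :=
  (u.1.2 * v.2 - u.2 * v.1.2, u.2 * v.1.1 - u.1.1 * v.2,
   u.1.1 * v.1.2 - u.1.2 * v.1.1).

Definition scale3 (k : R) (u : T3) : T3 := (k * u.1.1, k * u.1.2, k * u.2).

Definition comb3 (x y z : R) (u v w : T3) : T3 :=
  (x * u.1.1 + y * v.1.1 + z * w.1.1, x * u.1.2 + y * v.1.2 + z * w.1.2,
   x * u.2 + y * v.2 + z * w.2).

Definition independent3 (u v w : T3) :=
  forall x y z, comb3 x y z u v w = (0, 0, 0) -> [/\ x = 0, y = 0 & z = 0].

Definition triple (u v w : T3) : R := dot3 u (cross3 v w).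

Lemma cramer3 (u v w q : T3) :
  comb3 (triple q v w) (triple q w u) (triple q u v) u v w =
  scale3 (triple u v w) q.
Proof.
case: u v w q => [[u1 u2] u3] [[v1 v2] v3] [[w1 w2] w3] [[q1 q2] q3].
by rewrite /comb3 /scale3 /triple /dot3 /cross3/=; congr (_, _, _); ring.
Qed.

Lemma triple_neq0 (u v w : T3) : independent3 u v w -> triple u v w != 0.
Proof.
move=> ind; apply/eqP => d0.
have tr0 (q : T3) : triple q v w = 0.
  have := cramer3 u v w q; rewrite d0 /scale3 !mul0r => /ind.
  by case.
have c0 : cross3 v w = (0, 0, 0).
  have := tr0 (1, 0, 0); have := tr0 (0, 1, 0); have := tr0 (0, 0, 1).
  rewrite /triple /dot3 /= !mul0r !mul1r !add0r !addr0 => e3 e2 e1.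
  by rewrite /cross3 e1 e2 e3.
(* Expansion of the double cross product of [w] with [cross3 v w], which is zero; independence then
   forces [w = 0]. *)
have rel : comb3 0 (dot3 w w) (- dot3 v w) u v w = (0, 0, 0).
  have : cross3 w (cross3 v w) = (0, 0, 0).
    by rewrite c0 /cross3/= !mulr0 subrr.
  move=> <-; case: v w {ind d0 tr0 c0} => [[v1 v2] v3] [[w1 w2] w3].
  by rewrite /comb3 /dot3 /cross3/=; congr (_, _, _); ring.
have [_ ww0 _] := ind _ _ _ rel.
have w0 : w = (0, 0, 0).
  move: ww0; case: w {ind d0 tr0 c0 rel} => [[w1 w2] w3].
  rewrite /dot3/= => /eqP; rewrite !paddr_eq0 ?addr_ge0 -?expr2 ?sqr_ge0//
    !sqrf_eq0.
  by move=> /andP[/andP[/eqP -> /eqP ->] /eqP ->].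
have [|_ _] := ind 0 0 1; last by move/eqP; rewrite oner_eq0.
by rewrite /comb3 w0/= !mul0r !mulr0 !addr0.
Qed.

(* An inner normal of the face [v, w] of the cone over [u, v, w]: the factor
   makes its product with [u] the square of the triple product. *)
Definition face_normal (u v w : T3) : T3 := scale3 (triple u v w) (cross3 v w).

Definition cone3 (u v w : T3) : set T3 :=
  [set q | exists x y z, [/\ 0 <= x, 0 <= y, 0 <= z & q = comb3 x y z u v w]].

Lemma cone3_halfspaces (u v w : T3) : triple u v w != 0 ->
  cone3 u v w = halfspace (face_normal u v w)
    `&` halfspace (face_normal v w u) `&` halfspace (face_normal w u v).
Proof.
move=> d0; have d2 : 0 < triple u v w ^+ 2 by rewrite lt0r sqr_ge0 sqrf_eq0 d0.
have fn (a b c q : T3) : triple a b c = triple u v w ->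
    dot3 (face_normal a b c) q = triple u v w * triple q b c.
  by move=> e; rewrite /face_normal e /triple /dot3 /cross3 /scale3/=; ring.
have c1 : triple v w u = triple u v w by rewrite /triple /dot3 /cross3/=; ring.
have c2 : triple w u v = triple u v w by rewrite /triple /dot3 /cross3/=; ring.
apply/seteqP; split=> q.
  move=> [x [y [z [x0 y0 z0 ->]]]]; split; first split;
    rewrite /halfspace/= fn//.
  - rewrite (_ : _ * _ = x * triple u v w ^+ 2);
      first exact: mulr_ge0 x0 (ltW d2).
    by rewrite /triple /dot3 /cross3 /comb3/=; ring.
  - rewrite (_ : _ * _ = y * triple u v w ^+ 2);
      first exact: mulr_ge0 y0 (ltW d2).
    by rewrite /triple /dot3 /cross3 /comb3/=; ring.
  - rewrite (_ : _ * _ = z * triple u v w ^+ 2);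
      first exact: mulr_ge0 z0 (ltW d2).
    by rewrite /triple /dot3 /cross3 /comb3/=; ring.
move=> [[]]; rewrite /halfspace/= !fn// => x0 y0 z0.
exists (triple q v w / triple u v w), (triple q w u / triple u v w),
  (triple q u v / triple u v w).
have dv (x : R) : 0 <= triple u v w * x -> 0 <= x / triple u v w.
  move=> h; rewrite (_ : _ / _ = (triple u v w * x) / triple u v w ^+ 2).
    by rewrite divr_ge0// ltW.
  by field.
split; [exact: dv|exact: dv|exact: dv|].
have := cramer3 u v w q; move: (triple q v w) (triple q w u) (triple q u v) =>
  a b c.
rewrite /comb3 /scale3 [q]surjective_pairing [q.1]surjective_pairing/= => -[e1
  e2 e3].
by congr (_, _, _); apply: (mulfI d0); rewrite -?e1 -?e2 -?e3; field.
Qed.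

Lemma triple_gram (u v w : T3) : triple u v w ^+ 2 =
  dot3 u u * (dot3 v v * dot3 w w - dot3 v w ^+ 2)
  - dot3 u v * (dot3 u v * dot3 w w - dot3 v w * dot3 u w)
  + dot3 u w * (dot3 u v * dot3 v w - dot3 v v * dot3 u w).
Proof. by rewrite /triple /dot3 /cross3/=; ring. Qed.

Lemma triple_cycle (u v w : T3) : triple v w u = triple u v w.
Proof. by rewrite /triple /dot3 /cross3/=; ring. Qed.

Lemma dot3_scale (k : R) (a b : T3) :
  dot3 (scale3 k a) (scale3 k b) = k ^+ 2 * dot3 a b.
Proof. by rewrite /dot3 /scale3/=; ring. Qed.

Lemma dot_face_normal (u v w : T3) : dot3 (face_normal u v w) (face_normal v w
  u) =
  triple u v w ^+ 2 * (dot3 v w * dot3 u w - dot3 u v * dot3 w w).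
Proof.
rewrite /face_normal (triple_cycle u v w) dot3_scale; congr (_ * _).
by rewrite /dot3 /cross3/=; ring.
Qed.

(** Lagrange's identity, since the cross product of [cross3 v w] and [cross3 w u] is [triple u v w]
    times [w]; the scaling of the two normals adds a fourth power. *)
Lemma gram_face_normal (u v w : T3) :
  dot3 (face_normal u v w) (face_normal u v w)
    * dot3 (face_normal v w u) (face_normal v w u)
  - dot3 (face_normal u v w) (face_normal v w u) ^+ 2 =
  triple u v w ^+ 6 * dot3 w w.
Proof.
have e : dot3 (cross3 v w) (cross3 v w) * dot3 (cross3 w u) (cross3 w u)
    - dot3 (cross3 v w) (cross3 w u) ^+ 2 = triple u v w ^+ 2 * dot3 w w.
  by rewrite /triple /dot3 /cross3/=; ring.
rewrite /face_normal (triple_cycle u v w) !dot3_scale.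
transitivity (triple u v w ^+ 4 * (triple u v w ^+ 2 * dot3 w w)); last by ring.
by rewrite -e; ring.
Qed.

(** Edge vectors from the vertex of radius [A] to those of radii [B], [C], [D]; the mixed products
    come from the law of cosines. *)
Definition packing_gram (A B C D : R) (u v w : T3) :=
  [/\ dot3 u u = (A + B) ^+ 2, dot3 v v = (A + C) ^+ 2,
      dot3 w w = (A + D) ^+ 2 &
   [/\ dot3 u v = A * A + A * B + A * C - B * C,
      dot3 u w = A * A + A * B + A * D - B * D &
      dot3 v w = A * A + A * C + A * D - C * D]].

(** The triple product is six times the signed volume, so this links nondegeneracy of a placement
    with Q > 0. *)
Lemma packing_triple (A B C D : R) (u v w : T3) :
  0 < A -> 0 < B -> 0 < C -> 0 < D -> packing_gram A B C D u v w ->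
  triple u v w ^+ 2 = 4 * (A * B * C * D) ^+ 2 * packQ A^-1 B^-1 C^-1 D^-1.
Proof.
move=> A0 B0 C0 D0 [uu vv ww [uv uw vw]].
rewrite triple_gram uu vv ww uv uw vw /packQ; field.
by rewrite !gt_eqF.
Qed.

(** The two faces meet along [w], the edge between the radii [A] and [D]; [B] and [C] are off that
    edge. *)
Lemma packing_dihedral (A B C D : R) (u v w : T3) :
  0 < A -> 0 < B -> 0 < C -> 0 < D -> packing_gram A B C D u v w ->
  triple u v w != 0 ->
  let s := A^-1 + B^-1 + C^-1 + D^-1 in
  let Q := packQ A^-1 B^-1 C^-1 D^-1 in
  dihedral (face_normal u v w) (face_normal v w u) =
  face_angle s Q B^-1 + face_angle s Q C^-1.
Proof.
move=> A0 B0 C0 D0 gram d0 s Q.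
have d2 := packing_triple A0 B0 C0 D0 gram.
case: gram => [uu vv ww [uv uw vw]].
have Q0 : 0 < Q.
  have : 0 < triple u v w ^+ 2 by rewrite lt0r sqrf_eq0 d0 sqr_ge0.
  by rewrite d2 pmulr_rgt0// !(mulr_gt0, exprn_gt0).
set q := Num.sqrt Q; have q0 : 0 < q by rewrite sqrtr_gt0.
have qq : q ^+ 2 = Q by rewrite sqr_sqrtr// ltW.
rewrite /face_angle -/q atan_add; last first.
  rewrite -mulrDl divr_gt0// (_ : _ + _ = 2 * (A^-1 + D^-1)).
    by rewrite mulr_gt0// addr_gt0 ?invr_gt0.
  by rewrite /s; ring.
rewrite /dihedral; congr (_ + atan _).
rewrite gram_face_normal dot_face_normal.
(* Inserting the value of one factor [triple u v w ^+ 2] makes the radicand a perfect square. *)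
have -> : triple u v w ^+ 6 * dot3 w w =
    (triple u v w ^+ 2 * (2 * A * B * C * D * q * (A + D))) ^+ 2.
  transitivity (triple u v w ^+ 2 ^+ 2 * triple u v w ^+ 2 * dot3 w w).
    by ring.
  by rewrite {2}d2 -/Q -qq ww; ring.
have p0 : 0 < 2 * A * B * C * D * q * (A + D) by rewrite !(mulr_gt0, addr_gt0).
rewrite sqrtr_sqr (ger0_norm (mulr_ge0 (sqr_ge0 _) (ltW p0))).
rewrite -mulf_div divff ?sqrf_eq0// mul1r ww uv uw vw.
set a := s - _; set b := s - _.
have sab : a + b = 2 * (A^-1 + D^-1) by rewrite /a /b /s; ring.
have AD : A + D != 0 by rewrite gt_eqF// addr_gt0.
have ab0 : a + b != 0 by rewrite sab gt_eqF// mulr_gt0// addr_gt0// invr_gt0.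
transitivity ((a * b - Q) / (q * (a + b))); last first.
  by rewrite -qq; field; rewrite ab0 gt_eqF.
rewrite sab /a /b /s /Q /packQ; field.
by rewrite (addrC D) AD !gt_eqF.
Qed.

Lemma packing_gram_cycle (A B C D : R) (u v w : T3) :
  packing_gram A B C D u v w -> packing_gram A C D B v w u.
Proof.
have sym (x y : T3) : dot3 x y = dot3 y x by rewrite /dot3; ring.
move=> [uu vv ww [uv uw vw]]; split=> //.
by rewrite vw (sym v u) uv (sym w u) uw; split; ring.
Qed.

Lemma packing_corner (A B C D : R) (u v w : T3) :
  0 < A -> 0 < B -> 0 < C -> 0 < D -> packing_gram A B C D u v w ->
  triple u v w != 0 ->
  0 < packQ A^-1 B^-1 C^-1 D^-1 /\
  volume (cone3 u v w `&` unit_ball3) = (corner_angle A B C D A / 3)%:E.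
Proof.
move=> A0 B0 C0 D0 g1 d1.
have g2 := packing_gram_cycle g1.
have g3 := packing_gram_cycle g2.
have d2 : triple v w u != 0 by rewrite triple_cycle.
have d3 : triple w u v != 0 by rewrite triple_cycle.
split.
  have : 0 < triple u v w ^+ 2 by rewrite lt0r sqrf_eq0 d1 sqr_ge0.
  by rewrite (packing_triple A0 B0 C0 D0 g1) pmulr_rgt0// !(mulr_gt0,
    exprn_gt0).
have sq_gt0 (x : R) : 0 < x -> 0 < x ^+ 2 by move=> ?; rewrite exprn_gt0.
have gram_gt0 (x y z : T3) : triple x y z != 0 -> 0 < dot3 z z ->
    0 < dot3 (face_normal x y z) (face_normal x y z)
      * dot3 (face_normal y z x) (face_normal y z x)
    - dot3 (face_normal x y z) (face_normal y z x) ^+ 2.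
  move=> d z0; rewrite gram_face_normal mulr_gt0// (_ : 6 = 2 * 3)%N// exprM.
  by rewrite exprn_gt0// lt0r sqrf_eq0 d sqr_ge0.
have sym (x y : T3) : dot3 x y = dot3 y x by rewrite /dot3; ring.
have dsym (x y : T3) : dihedral x y = dihedral y x.
  by rewrite /dihedral (sym x y) (mulrC (dot3 x x)).
have [uu vv ww _] := g1.
(* The edges to [D], [B] and [C] in turn; the face angles of [B], [C], [D] each occur twice in the
   total. *)
have e1 := packing_dihedral A0 B0 C0 D0 g1 d1.
have e2 := packing_dihedral A0 C0 D0 B0 g2 d2.
have e3 := packing_dihedral A0 D0 B0 C0 g3 d3.
rewrite cone3_halfspaces// volume_corner.
- congr EFin; congr (_ / _).
  rewrite [in dihedral (face_normal u v w) (face_normal w u v)]dsym.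
  rewrite e1 e2 e3 /corner_angle.
  set s := A^-1 + B^-1 + C^-1 + D^-1; set Q := packQ A^-1 B^-1 C^-1 D^-1.
  have -> : A^-1 + C^-1 + D^-1 + B^-1 = s by rewrite /s; ring.
  have -> : A^-1 + D^-1 + B^-1 + C^-1 = s by rewrite /s; ring.
  have -> : packQ A^-1 C^-1 D^-1 B^-1 = Q by rewrite /Q /packQ; ring.
  have -> : packQ A^-1 D^-1 B^-1 C^-1 = Q by rewrite /Q /packQ; ring.
  by ring.
- by apply: gram_gt0 => //; rewrite ww; apply: sq_gt0; exact: addr_gt0.
- by apply: gram_gt0 => //; rewrite uu; apply: sq_gt0; exact: addr_gt0.
- rewrite sym mulrC; apply: gram_gt0 => //; rewrite vv; apply: sq_gt0;
    exact: addr_gt0.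
Qed.

End vectors.

(** * Placements of a tetrahedron in coordinates *)

Section placement.
Context {R : realType}.
Local Notation T := (measurableTypeR R).
Local Notation T3 := (T * T * T)%type.
Definition coords (v : 'rV[R]_3) : T3 :=
  (v 0 ord0, v 0 (lift ord0 ord0), v 0 (lift ord0 (lift ord0 ord0))).

Lemma coords_inj : injective coords.
Proof.
move=> v w [e0 e1 e2]; apply/rowP => -[[|[|[|m]]]]// hm.
- by rewrite (_ : Ordinal hm = ord0)//; apply: val_inj.
- by rewrite (_ : Ordinal hm = lift ord0 ord0)//; apply: val_inj.
- by rewrite (_ : Ordinal hm = lift ord0 (lift ord0 ord0))//; apply: val_inj.
Qed.

Lemma row3K (q : T3) : coords (row3 q) = q.
Proof. by case: q => [[x y] z]; rewrite /coords /row3 !mxE. Qed.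

Lemma enormE (v : 'rV[R]_3) : enorm v = Num.sqrt (dot3 (coords v) (coords v)).
Proof.
by rewrite /enorm !big_ord_recl big_ord0 addr0 addrA /dot3/= !expr2.
Qed.

Lemma sqr_enorm (v : 'rV[R]_3) : enorm v ^+ 2 = dot3 (coords v) (coords v).
Proof.
by rewrite enormE sqr_sqrtr// /dot3 -!expr2 !addr_ge0 ?sqr_ge0.
Qed.

Context (N : nat) (r : 'rV[R]_N) (t : {set 'I_N}) (i j k l : 'I_N).
Context (uniq_ijkl : uniq [:: i; j; k; l]).
Context (tE : t = i |: (j |: (k |: [set l]))).

Lemma sum_tetra (V : nmodType) (F : 'I_N -> V) :
  \sum_(m in t) F m = F i + F j + F k + F l.
Proof.
move: uniq_ijkl => /= /and4P[ni nj nk _].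
have kl : k \notin [set l]%SET by move: nk; rewrite !inE.
have jkl : j \notin k |: [set l] by move: nj; rewrite !inE.
have ijkl : i \notin j |: (k |: [set l]) by move: ni; rewrite !inE.
by rewrite tE (big_setU1 _ ijkl) (big_setU1 _ jkl) (big_setU1 _ kl) big_set1 /=
  !addrA.
Qed.

Context (p : 'I_N -> 'rV[R]_3).
Let u := coords (p j - p i).
Let v := coords (p k - p i).
Let w := coords (p l - p i).

Let wt (a x y z : R) (m : 'I_N) : R :=
  if m == j then x else if m == k then y else if m == l then z else a.

Let wtE a x y z : [/\ wt a x y z i = a, wt a x y z j = x, wt a x y z k = y &
  wt a x y z l = z].
Proof.
move: uniq_ijkl; rewrite /= !inE !negb_or => /and4P[/and3P[ij ik il] /andP[jk
  jl] kl _].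
rewrite /wt eqxx (negbTE ij) (negbTE ik) (negbTE il).
by rewrite (eq_sym k) (negbTE jk) (eq_sym l j) (negbTE jl) (eq_sym l k) (negbTE
  kl) !eqxx.
Qed.

Lemma corner_cone_coords :
  @row3 R @^-1` (corner_cone t p i `&` [set x | enorm x <= 1]) =
  cone3 u v w `&` unit_ball3.
Proof.
apply/seteqP; split=> q [].
  move=> [c c0]; rewrite sum_tetra subrr scaler0 add0r => qE nq; split.
    exists (c j), (c k), (c l); split=> //.
    by rewrite -[LHS]row3K qE /comb3 /u /v /w /coords/= !mxE.
  move: nq; rewrite /unit_ball3/= enormE row3K => h.
  by rewrite -(@ler_sqrt _ _ 1)// sqrtr1.
move=> [x [y [z [x0 y0 z0 qE]]]] nq; split.
  exists (wt 0 x y z) => [m|].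
    by rewrite /wt; do 3!case: ifP => // _.
  apply: coords_inj; rewrite row3K qE sum_tetra.
  have [-> -> -> ->] := wtE 0 x y z.
  by rewrite scale0r add0r /comb3 /u /v /w /coords/= !mxE.
by rewrite /= enormE row3K -sqrtr1 ler_sqrt.
Qed.

Lemma affinely_independent_coords :
  affinely_independent t p -> independent3 u v w.
Proof.
move=> ind x y z xyz0.
(* The weight at [i] makes the total zero, which turns a linear relation of edge vectors into an
   affine one of vertices. *)
have [ei ej ek el] := wtE (- x - y - z) x y z.
have [] : [/\ wt (- x - y - z) x y z j = 0, wt (- x - y - z) x y z k = 0
    & wt (- x - y - z) x y z l = 0]; last by rewrite ej ek el.
have wt0 : \sum_(m in t) wt (- x - y - z) x y z m = 0.
  by rewrite sum_tetra ei ej ek el; ring.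
have wtp0 : \sum_(m in t) wt (- x - y - z) x y z m *: p m = 0.
  rewrite sum_tetra ei ej ek el; apply: coords_inj.
  transitivity (comb3 x y z u v w).
    by rewrite /comb3 /u /v /w /coords/= !mxE; congr (_, _, _); ring.
  by rewrite xyz0 /coords !mxE.
by split; apply: (ind _ wt0 wtp0); rewrite tE !inE eqxx ?orbT.
Qed.

Context (r_gt0 : forall m, 0 < r 0 m).
Context (placed : tetra_placement r t p).

Lemma placement_gram :
  packing_gram (r 0 i) (r 0 j) (r 0 k) (r 0 l) u v w.
Proof.
have [_ dist] := placed.
move: uniq_ijkl; rewrite /= !inE !negb_or => /and4P[/and3P[ij ik il] /andP[jk
  jl] kl _].
have [ti tj tk tl] : [/\ i \in t, j \in t, k \in t & l \in t].
  by rewrite tE !inE !eqxx ?orbT.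
have uu : dot3 u u = (r 0 i + r 0 j) ^+ 2.
  by rewrite -sqr_enorm dist// 1?eq_sym// addrC.
have vv : dot3 v v = (r 0 i + r 0 k) ^+ 2.
  by rewrite -sqr_enorm dist// 1?eq_sym// addrC.
have ww : dot3 w w = (r 0 i + r 0 l) ^+ 2.
  by rewrite -sqr_enorm dist// 1?eq_sym// addrC.
have polar (a b : 'I_N) : a \in t -> b \in t -> a != b ->
    dot3 (coords (p a - p i)) (coords (p a - p i))
    + dot3 (coords (p b - p i)) (coords (p b - p i))
    - 2 * dot3 (coords (p a - p i)) (coords (p b - p i)) = (r 0 a + r 0 b) ^+ 2.
  move=> ta tb ab; rewrite -(dist _ _ ta tb ab) sqr_enorm.
  by rewrite /dot3 /coords !mxE/=; ring.
have := polar _ _ tj tk jk; have := polar _ _ tj tl jl;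
  have := polar _ _ tk tl kl.
rewrite -/u -/v -/w uu vv ww => vw uw uv.
by split=> //; split; lra.
Qed.

Lemma placement_solid_angle :
  0 < packQ (r 0 i)^-1 (r 0 j)^-1 (r 0 k)^-1 (r 0 l)^-1 /\
  corner_solid_angle t p i =
  corner_angle (r 0 i) (r 0 j) (r 0 k) (r 0 l) (r 0 i).
Proof.
have [ind _] := placed.
have [Q0 V] := packing_corner (r_gt0 i) (r_gt0 j) (r_gt0 k) (r_gt0 l)
  placement_gram (triple_neq0 (affinely_independent_coords ind)).
split=> //.
rewrite /corner_solid_angle /volume3 corner_cone_coords.
rewrite [X in fine X](_ : _ = (corner_angle (r 0 i) (r 0 j) (r 0 k) (r 0 l) (r
  0 i) / 3)%:E)//.
by rewrite /= mulrC divfK.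
Qed.

End placement.

(** [get] returns the value at some placement, one being available, and the formula involves only
    the radii, so the choice is immaterial. *)
Lemma packing_solid_angle (R : realType) (N : nat) (r : 'rV[R]_N)
    (t : {set 'I_N}) (i j k l : 'I_N) :
  uniq [:: i; j; k; l] -> t = i |: (j |: (k |: [set l])) ->
  (forall m, 0 < r 0 m) -> (exists p, tetra_placement r t p) ->
  0 < packQ (r 0 i)^-1 (r 0 j)^-1 (r 0 k)^-1 (r 0 l)^-1 /\
  solid_angle r t i = corner_angle (r 0 i) (r 0 j) (r 0 k) (r 0 l) (r 0 i).
Proof.
move=> uijkl tE r0 [p0 hp0].
have [Q0 _] := @placement_solid_angle R N r t i j k l uijkl tE p0 r0 hp0.
split=> //; rewrite /solid_angle;
  case: xgetP => [a _ [p hp ->]|/(_ (corner_solid_angle t p0 i))[]].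
  by have [_ ->] := @placement_solid_angle R N r t i j k l uijkl tE p r0 hp.
by exists p0.
Qed.

Lemma tetra_enum (N : nat) (t : {set 'I_N}) : #|t| = 4%N ->
  exists i j k l, uniq [:: i; j; k; l] /\ t = i |: (j |: (k |: [set l])).
Proof.
rewrite cardE => t4; have := enum_uniq t; have := mem_enum t.
case: (enum t) t4 => [|i [|j [|k [|l []]]]]// _ mt ut.
exists i, j, k, l; split=> //; apply/setP => m.
by rewrite -mt !inE.
Qed.

(** * Isolation *)

(** For symmetry in the first four arguments; [th] stands for the face angle, so that each
    hypothesis is a ring identity for a given permutation. *)
Lemma corner_angle_perm (R : realType) (a b c d a' b' c' d' x : R) :
  a^-1 + b^-1 + c^-1 + d^-1 = a'^-1 + b'^-1 + c'^-1 + d'^-1 ->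
  packQ a^-1 b^-1 c^-1 d^-1 = packQ a'^-1 b'^-1 c'^-1 d'^-1 ->
  (forall th : R -> R, th a^-1 + th b^-1 + th c^-1 + th d^-1 =
    th a'^-1 + th b'^-1 + th c'^-1 + th d'^-1) ->
  corner_angle a b c d x = corner_angle a' b' c' d' x.
Proof. by move=> sE QE thE; rewrite /corner_angle sE QE thE. Qed.

Section packing.
Context {R : realType} (N : nat) (T : {set {set 'I_N}}).

(** [packQ] of the curvatures without an ordering of the vertices. *)
Definition tetraQ (r : 'rV[R]_N) (t : {set 'I_N}) : R :=
  (\sum_(m in t) (r 0 m)^-1) ^+ 2 - 2 * \sum_(m in t) (r 0 m)^-1 ^+ 2.

Lemma tetraQE (r : 'rV[R]_N) t (i j k l : 'I_N) :
  uniq [:: i; j; k; l] -> t = (i |: (j |: (k |: [set l])))%SET ->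
  tetraQ r t = packQ (r 0 i)^-1 (r 0 j)^-1 (r 0 k)^-1 (r 0 l)^-1.
Proof. by move=> u tE; rewrite /tetraQ !(sum_tetra u tE). Qed.

Lemma near_tetraQ_gt0 (s : 'rV[R]_N) (t : {set 'I_N}) :
  (forall i, 0 < s 0 i) -> 0 < tetraQ s t ->
  \forall r \near s, 0 < tetraQ r t.
Proof.
move=> s0 Q0.
have FF : Filter (nbhs s) := nbhs_filter s.
have cinv (m : 'I_N) : (fun r : 'rV[R]_N => (r 0 m)^-1) @ s --> (s 0 m)^-1.
  have cm : (fun r : 'rV[R]_N => r 0 m) @ s --> s 0 m.
    exact: coord_continuous.
  exact: cvgV (lt0r_neq0 (s0 m)) cm.
have csum (F : 'I_N -> 'rV[R]_N -> R) : (forall m, F m @ s --> F m s) ->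
    (fun r => \sum_(m in t) F m r) @ s --> \sum_(m in t) F m s.
  move=> cF; apply: (@cvg_big R^o _ +%R 0 _ add_continuous _ (nbhs s) _
    (fun m r => F m r) (fun m => F m s)) => m _; exact: cF.
have c1 := csum (fun m r => (r 0 m)^-1) cinv.
have c2 : (fun r : 'rV[R]_N => \sum_(m in t) (r 0 m)^-1 * (r 0 m)^-1) @ s -->
    \sum_(m in t) (s 0 m)^-1 * (s 0 m)^-1.
  by apply: (csum (fun m r => (r 0 m)^-1 * (r 0 m)^-1)) => m; apply: cvgM;
    exact: cinv.
have cQ : (fun r : 'rV[R]_N => (\sum_(m in t) (r 0 m)^-1) * (\sum_(m in t) (r 0
  m)^-1)
    - 2 * \sum_(m in t) (r 0 m)^-1 * (r 0 m)^-1) @ s --> tetraQ s t.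
  by apply: cvgB; apply: cvgM; [exact: c1|exact: c1|exact: cvg_cst|exact: c2].
exact: cvgr_gt cQ _ Q0.
Qed.

(** Finitely many tetrahedra allow one common ball, and a ball contains the segments from its
    centre. *)
Lemma convex_nbhs_tetraQ (s : 'rV[R]_N) :
  (forall i, 0 < s 0 i) -> (forall t, t \in T -> 0 < tetraQ s t) ->
  exists2 U, nbhs s U & forall r, U r -> forall u : R, 0 <= u <= 1 ->
    forall t, t \in T -> 0 < tetraQ (s + u *: (r - s)) t.
Proof.
move=> s0 Q0.
have : \forall r \near s, forall t, t \in T -> 0 < tetraQ r t.
  apply: (@filter_forall _ _ (fun t (r : 'rV[R]_N) => t \in T -> 0 < tetraQ r
    t) (nbhs s)) => t; have [tT|tT] := boolP (t \in T).
    by have := near_tetraQ_gt0 s0 (Q0 t tT); apply: filterS.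
  by apply: filterE => r h; case/negP: tT.
move=> /nbhs_ballP[e /= e0 he]; exists (ball s e); first exact: nbhsx_ballx.
move=> r sr u /andP[u0 u1] t tT; case: sr => _ sr; apply: he => //;
  split=> // a b.
move: (sr a b); rewrite /ball/= !mxE => h.
rewrite opprD addNKr normrN normrM ger0_norm//.
rewrite distrC in h; apply: le_lt_trans h.
by rewrite ler_piMl.
Qed.

Definition vertex_point (i : 'I_N) : 'rV[R]_N := \row_j (j == i)%:R.

Lemma vertex_point_realization (i : 'I_N) t :
  t \in T -> i \in t -> realization R T (vertex_point i).
Proof.
move=> tT it; split.
- by move=> j; rewrite mxE ler0n.
- rewrite (bigD1 i)//= big1 ?mxE ?eqxx ?addr0// => j ji.
  by rewrite mxE (negbTE ji).
- exists t => // j; rewrite mxE; have [->//|_] := eqVneq j i.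
  by rewrite eqxx.
Qed.

(* The sum of the barycentric coordinates indexed by [C] is continuous and takes
   only the values 0 and 1 on the realization. *)
Lemma connected_vertices (M : topologicalType) (C : {set 'I_N}) (i0 : 'I_N) :
  connected [set: M] -> triangulates R T M ->
  (forall t, t \in T -> forall i j, i \in t -> j \in t -> (i \in C) = (j \in
    C)) ->
  i0 \in C -> forall i, i \in C.
Proof.
move=> cM [_ cover [f [g [_ cg [fA gB] gf fg]]]] Ct i0C i.
pose h (x : 'rV[R]_N) : R := \sum_(j in C) x 0 j.
have h01 x : realization R T x -> h x = 0 \/ h x = 1.
  move=> [x0 x1 [t tT xt]].
  have [m /andP[mt mC]|none] := pickP [pred m | (m \in t) && (m \in C)].
    right; rewrite -x1 /h big_mkcond/=; apply: eq_bigr => j _.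
    case: ifPn => // jC; have [//|/xt jt] := eqVneq (x 0 j) 0.
    by move: jC; rewrite (Ct t tT j m jt mt) mC.
  left; apply: big1 => j jC; have [//|/xt jt] := eqVneq (x 0 j) 0.
  by have := none j; rewrite /= jt jC.
have hv j : h (vertex_point j) = (j \in C)%:R.
  rewrite /h; have [jC|jC] := boolP (j \in C).
    rewrite (bigD1 j)//= big1 ?mxE ?eqxx ?addr0// => m /andP[_ mj].
    by rewrite mxE (negbTE mj).
  apply: big1 => m mC; rewrite mxE; have [mj|//] := eqVneq m j.
  by move: jC; rewrite -mj mC.
have vert j : realization R T (vertex_point j).
  by have [t tT jt] := cover j; exact: vertex_point_realization tT jt.
have ch : continuous h.
  move=> x; apply: (@cvg_big R^o _ +%R 0 _ add_continuous _ (nbhs x) _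
    (fun j r => r 0 j) (fun j => x 0 j)) => j _; exact: coord_continuous.
have chg : continuous (h \o g).
  have cg' : continuous g by apply/continuous_subspace_setT.
  by move=> m; apply: continuous_comp; [exact: cg'|exact: ch].
pose B := [set m | 1 / 2 < h (g m)].
(* As [h] skips the values between 0 and 1, the strict and the weak inequality agree, so [B] is both
   open and closed. *)
have BE : B = [set m | 1 / 2 <= h (g m)].
  apply/seteqP; split=> m /=; first exact: ltW.
  by rewrite /B/=; case: (h01 _ (gB m I)) => -> ?; lra.
have BT : B = [set: M].
  apply: cM.
  - exists (f (vertex_point i0)); rewrite /B/= gf; last exact: vert.
    by rewrite hv i0C/=; lra.
  - exists B; last by rewrite setTI.
    by apply: (@open_comp _ _ (h \o g) [set x | 1 / 2 < x]) => [m _|];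
      [exact: chg|exact: open_gt].
  - exists B; last by rewrite setTI.
    rewrite BE.
    by apply: (@closed_comp _ _ (h \o g) [set x | 1 / 2 <= x]) => [m _|];
      [exact: chg|exact: closed_ge].
have : B (f (vertex_point i)) by rewrite BT.
rewrite /B/= gf; last exact: vert.
by rewrite hv; case: (i \in C) => //=; lra.
Qed.

Definition tetra_pairing (r s : 'rV[R]_N) (t : {set 'I_N}) : R :=
  \sum_(i in t) (solid_angle r t i - solid_angle s t i) * (r 0 i - s 0 i).

Lemma tetra_pairing_le0 (r s : 'rV[R]_N) (t : {set 'I_N}) : #|t| = 4%N ->
  (forall i, 0 < r 0 i) -> (forall i, 0 < s 0 i) ->
  (exists p, tetra_placement r t p) -> (exists p, tetra_placement s t p) ->
  (forall u : R, 0 <= u <= 1 -> 0 < tetraQ (s + u *: (r - s)) t) ->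
  tetra_pairing r s t <= 0 /\
  (0 <= tetra_pairing r s t ->
   forall i j, i \in t -> j \in t -> r 0 i * s 0 j = r 0 j * s 0 i).
Proof.
move=> t4 r0 s0 rp sp Qu.
have [i [j [k [l [u4 tE]]]]] := tetra_enum t4.
have angle (a b c d : 'I_N) (x : 'rV[R]_N) : (forall m, 0 < x 0 m) ->
    (exists p, tetra_placement x t p) ->
    uniq [:: a; b; c; d] -> t = (a |: (b |: (c |: [set d])))%SET ->
    solid_angle x t a = corner_angle (x 0 a) (x 0 b) (x 0 c) (x 0 d) (x 0 a).
  by move=> x0 xp u tE'; have [] := packing_solid_angle u tE' x0 xp.
move: (u4); rewrite /= !inE !negb_or => /and4P[/and3P[ij ik il] /andP[jk jl] kl
  _].
(* [packing_solid_angle] gives the angle at the first listed vertex, so each vertex is moved to the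
   front once. *)
have u2 : uniq [:: j; i; k; l].
  by rewrite /= !inE !negb_or (eq_sym j i) ij ik il jk jl kl.
have u3 : uniq [:: k; i; j; l].
  by rewrite /= !inE !negb_or (eq_sym k i) (eq_sym k j) ij ik il jk jl kl.
have u4' : uniq [:: l; i; j; k].
  by rewrite /= !inE !negb_or (eq_sym l i) (eq_sym l j) (eq_sym l k) ij ik il
    jk jl kl.
have t2 : t = (j |: (i |: (k |: [set l])))%SET.
  by rewrite tE; apply/setP => m; rewrite !inE orbCA.
have t3 : t = (k |: (i |: (j |: [set l])))%SET.
  by rewrite tE; apply/setP => m; rewrite !inE; do !case: eqP.
have t4' : t = (l |: (i |: (j |: [set k])))%SET.
  by rewrite tE; apply/setP => m; rewrite !inE; do !case: eqP.
have angles (x : 'rV[R]_N) : (forall m, 0 < x 0 m) ->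
    (exists p, tetra_placement x t p) ->
    let A := corner_angle (x 0 i) (x 0 j) (x 0 k) (x 0 l) in
    [/\ solid_angle x t i = A (x 0 i), solid_angle x t j = A (x 0 j),
        solid_angle x t k = A (x 0 k) & solid_angle x t l = A (x 0 l)].
  move=> x0 xp A; rewrite (angle _ _ _ _ _ x0 xp u4 tE) (angle _ _ _ _ _ x0 xp
    u2 t2).
  rewrite (angle _ _ _ _ _ x0 xp u3 t3) (angle _ _ _ _ _ x0 xp u4' t4').
  by split=> //; rewrite /A; apply: corner_angle_perm => [||th];
    rewrite /packQ; ring.
have [ai aj ak al] := angles r r0 rp; have [bi bj bk bl] := angles s s0 sp.
rewrite /tetra_pairing (sum_tetra u4 tE) ai aj ak al bi bj bk bl.
have [|X0 X1] := @corner_angle_monotone R _ _ _ _ _ _ _ _ (r0 i) (r0 j) (r0 k)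
  (r0 l)
  (s0 i) (s0 j) (s0 k) (s0 l).
  by move=> u u01; have := Qu u u01; rewrite (tetraQE _ u4 tE) !mxE.
split=> // /X1[ej ek el].
have base a : a \in t -> r 0 a * s 0 i = r 0 i * s 0 a.
  by rewrite tE !inE => /or4P[] /eqP ->.
move=> a b ta tb; apply: (mulIf (lt0r_neq0 (s0 i))).
by rewrite mulrAC base// [RHS]mulrAC base// mulrAC.
Qed.

(** The constants [4 * pi] cancel, and the sum over incident vertices and tetrahedra is
    exchanged. *)
Lemma curvature_pairing (r s : 'rV[R]_N) :
  \sum_i (curvature T r i - curvature T s i) * (r 0 i - s 0 i) =
  - \sum_(t in T) tetra_pairing r s t.
Proof.
rewrite -sumrN /tetra_pairing.
under [RHS]eq_bigr do rewrite -sumrN.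
rewrite (exchange_big_dep predT)//=.
apply: eq_bigr => i _; rewrite /curvature opprD opprK addrACA subrr add0r.
rewrite -sumrN -big_split/= big_distrl/=; apply: eq_bigr => t _; ring.
Qed.

Lemma isolated_packing (M : topologicalType) (r s : 'rV[R]_N) :
  connected [set: M] -> triangulates R T M ->
  (sphere_packing_metric T `&` unit_sphere3 R N) r ->
  (sphere_packing_metric T `&` unit_sphere3 R N) s ->
  nonpositive_constant_curvature T r -> nonpositive_constant_curvature T s ->
  (forall u : R, 0 <= u <= 1 -> forall t, t \in T ->
    0 < tetraQ (s + u *: (r - s)) t) ->
  r = s.
Proof.
move=> cM tri [[r0 rp] r1] [[s0 sp] s1] [la la0 rc] [mu mu0 sc] Qu.
have [card4 _ _] := tri.
have curvE (x : 'rV[R]_N) (c : R) i : (forall i, 0 < x 0 i) ->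
    (forall i, scalar_curvature T x i = c) -> curvature T x i = c * x 0 i ^+ 2.
  by move=> x0 xc; rewrite -(xc i) /scalar_curvature divfK// gt_eqF// exprn_gt0.
have amgm (x y : 'rV[R]_N) : (forall i, 0 < x 0 i) -> (forall i, 0 < y 0 i) ->
    unit_sphere3 R N x -> unit_sphere3 R N y ->
    \sum_i x 0 i ^+ 2 * y 0 i <= 1.
  move=> x0 y0 x1 y1.
  have -> : 1 = \sum_i (2 / 3 * x 0 i ^+ 3 + 3^-1 * y 0 i ^+ 3) :> R.
    by rewrite big_split/= -!mulr_sumr x1 y1; field.
  apply: ler_sum => i _; rewrite -subr_ge0.
  (* The weighted mean inequality with weights 2/3 and 1/3, in factored form. *)
  rewrite (_ : _ - _ = (x 0 i - y 0 i) ^+ 2 * (2 * x 0 i + y 0 i) / 3);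
    last by field.
  by rewrite divr_ge0// mulr_ge0 ?sqr_ge0// addr_ge0 ?mulr_ge0// ltW.
have pairing : \sum_i (curvature T r i - curvature T s i) * (r 0 i - s 0 i) <=
  0.
  have -> : \sum_i (curvature T r i - curvature T s i) * (r 0 i - s 0 i) =
      la * (1 - \sum_i r 0 i ^+ 2 * s 0 i) + mu * (1 - \sum_i s 0 i ^+ 2 * r 0
        i).
    rewrite -{1}r1 -s1 -!sumrB !mulr_sumr -big_split/=; apply: eq_bigr => i _.
    by rewrite (curvE r la)// (curvE s mu)//; ring.
  have := amgm _ _ r0 s0 r1 s1; have := amgm _ _ s0 r0 s1 r1 => h1 h2.
  by rewrite -[leRHS]addr0 lerD// mulr_le0_ge0// subr_ge0.
have term t : t \in T -> tetra_pairing r s t <= 0 /\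
  (0 <= tetra_pairing r s t ->
   forall i j, i \in t -> j \in t -> r 0 i * s 0 j = r 0 j * s 0 i).
  move=> tT; apply: tetra_pairing_le0 => //;
    [exact: card4|exact: rp|exact: sp|].
  by move=> u u01; exact: Qu.
have prop t : t \in T ->
    forall i j, i \in t -> j \in t -> r 0 i * s 0 j = r 0 j * s 0 i.
  move=> tT; apply: (term t tT).2.
  (* The pairings have nonnegative sum although each is nonpositive, so every one vanishes. *)
  move: pairing; rewrite curvature_pairing oppr_le0 (bigD1 t)//= => h.
  have : \sum_(i in T | i != t) tetra_pairing r s i <= 0.
    by apply: sumr_le0 => t' /andP[t'T _]; exact: (term t' t'T).1.
  lra.
apply/rowP => i.
(* The vertices at which the ratio of [r] to [s] is the same as at [i]. *)
pose C : {set 'I_N} := [set j | r 0 j * s 0 i == r 0 i * s 0 j]%SET.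
have allC : forall j, j \in C.
  apply: (@connected_vertices M C i cM tri) => [t tT j k jt kt|];
    last by rewrite inE.
  have jk := prop t tT j k jt kt; rewrite !inE.
  rewrite -(inj_eq (mulIf (lt0r_neq0 (s0 k)))) -[RHS](inj_eq (mulIf (lt0r_neq0
    (s0 j)))).
  by rewrite mulrAC jk; congr (_ == _); ring.
have e j : r 0 j = r 0 i / s 0 i * s 0 j.
  have := allC j; rewrite inE => /eqP h.
  by apply: (mulIf (lt0r_neq0 (s0 i))); rewrite h; field; rewrite gt_eqF.
(* The common ratio is fixed by the normalization of both metrics. *)
have : (r 0 i / s 0 i) ^+ 3 = 1.
  rewrite -r1 -[LHS]mulr1 -s1 mulr_sumr; apply: eq_bigr => j _.
  by rewrite -exprMn -e.
have k0 : 0 <= r 0 i / s 0 i by rewrite divr_ge0// ltW.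
move=> /eqP; rewrite pexpr_eq1// => /eqP k1.
by rewrite [LHS]e k1 mul1r.
Qed.

End packing.

Theorem theorem6p8 (R : realType) (M : topologicalType)
    (hM : compact_connected_3manifold R M)
    (N : nat) (T : {set {set 'I_N}}) (hT : triangulates R T M)
    (rs : 'rV[R]_N)
    (hrs : (sphere_packing_metric T `&` unit_sphere3 R N) rs)
    (hcurv : nonpositive_constant_curvature T rs) :
  exists2 U : set 'rV[R]_N, nbhs rs U &
    forall r : 'rV[R]_N,
      ((sphere_packing_metric T `&` unit_sphere3 R N) `&` U) r ->
      nonpositive_constant_curvature T r -> r = rs.
Proof.
have [_ _ _ _ cM] := hM; have [[rs0 rsp] _] := hrs; have [card4 _ _] := hT.
have Q0 t : t \in T -> 0 < tetraQ rs t.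
  move=> tT; have [i [j [k [l [u4 tE]]]]] := tetra_enum (card4 t tT).
  rewrite (tetraQE _ u4 tE).
  by have [] := packing_solid_angle u4 tE rs0 (rsp t tT).
have [U nU hU] := convex_nbhs_tetraQ rs0 Q0.
exists U => // r [hr Ur] rcurv.
exact: (isolated_packing cM hT hr hrs rcurv hcurv (hU r Ur)).
Qed.
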